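(* Let $n\ge 2$ be an integer, $\alpha\in(0,1]$, and let $\epsilon>0$ be an arbitrarily small constant. If the constant $c>0$ is sufficiently large, then running the construction algorithm described in the context with parameter $\alpha/2$ in place of $\alpha$ produces, with high probability in polynomial time, an $(n,\alpha)$-URSC whose elongation satisfies $\tau(n,k)=O\!\left(\frac{k^2}{\alpha^{2+\epsilon}}\ln n\right)$ for every $1<k\le n$. The same result also holds in expectation (the expected running time is polynomial).
   Context: Binary vectors of length $t$ are indexed by positions $0,\dots,t-1$. For $\mathbf{x}=(x_0,\dots,x_{t-1})$ and an integer $i$, the cyclic shift $\mathbf{x}(i)$ is the vector whose $r$-th entry is $x_{(r+i)\bmod t}$; $S(\mathbf{x})$ is the set of all cyclic shifts of $\mathbf{x}$. $|\mathbf{x}|$ is the number of 1's of $\mathbf{x}$; $\vee,\wedge$ are bitwise OR/AND; $\mathbf{x}_{[a,b]}$ is the subvector $(x_a,\dots,x_b)$. For a set $R=\{\mathbf{y}_1,\dots,\mathbf{y}_r\}$ of vectors, $S_\vee(R)=\{\bigvee_{i=1}^r \mathbf{z}_i : \mathbf{z}_i\in S(\mathbf{y}_i)\}$. The slipped vector of $\mathbf{z}$ is $\mathbf{z}^*=\mathbf{z}(-1)\vee\mathbf{z}\vee\mathbf{z}(1)$. For a $t\times n$ binary matrix $\mathbf{M}$, $[\mathbf{c}_j]$ denotes its column $j$ (a codeword). URSC: Given $n$, a function $\tau:\mathbb{N}\times\mathbb{N}\to[0,t)$ with $t\ge n$, and a real $0<\alpha\le1$, a $t\times n$ binary matrix $\mathbf{M}$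 is an $(n,\alpha)$-ultra-resilient superimposed code ($(n,\alpha)$-URSC) of elongation $\tau$ if for every $2\le k\le n$, every set $T$ of $k$ column indices, every $c_j\in T$ and every $\mathbf{z}\in S_\vee(\{[\mathbf{c}_m]: c_m\in T\setminus\{c_j\}\})$, we have $\left|([\mathbf{c}_j]\wedge\mathbf{z}^* )_{[0,\tau(n,k)]}\right|<\alpha\,\left|[\mathbf{c}_j]_{[0,\tau(n,k)]}\right|$. Random matrix $\mathcal{M}(n,\alpha,\epsilon,c)$: a binary matrix with $n$ columns and $t=(c/\alpha^{2+\epsilon})n^2\ln n$ rows (rounding ignored), in which the entry in row $r$ ($0\le r<t$) of each column is independently $1$ with probability $p(r)=1/\sqrt{\lfloor r/\ln n\rfloor+1}$ and $0$ otherwise. Collision Bound Property $\mathcal{P}(\mathbf{M},\alpha,\tau_1,\tau_2)$ for a $t\times n$ binary matrix and integer functions $\tau_1,\tau_2:\mathbb{N}\times\mathbb{N}\to[0,t)$: for every $1<k\le n$, every ordered pair of distinct column indices $c_j,c_{j'}$ and every $0\le i\le t-1$: (Weight Inequality) $|[\mathbf{c}_j]_{[0,\tau_1(n,k)]}|\le\alpha\,|[\mathbf{c}_j]_{[\tau_1(n,k),\tau_2(n,k)]}|$, and (Collision Weight Inequality) $\left|\big([\mathbf{c}_j]\wedge([\mathbf{c}_{j'}](i-1)\vee[\mathbf{c}_{j'}](i)\vee[\mathbf{c}_{j'}](i+1))\big)_{[\tau_1(n,k),\tau_2(n,k)]}\right|\le\left\lfloor\frac{\alpha|[\mathbf{c}_j]_{[\tau_1(n,k),\tau_2(n,k)]}|-1}{k-1}\right\rfloor$.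 Construction algorithm (input $n\ge2$, $\alpha\in(0,1]$, constants $\epsilon>0$, $c>0$): set $\tau_1(n,k)=(c/64)k^2\ln n$ and $\tau_2(n,k)=c\,(k^2/\alpha^{2+\epsilon})\ln n$; repeatedly generate a random matrix $\mathbf{M}=\mathcal{M}(n,\alpha,\epsilon,c)$ until $\mathcal{P}(\mathbf{M},\alpha,\tau_1,\tau_2)$ holds (checked exhaustively over all $k$, pairs of columns and shifts); output the last $\mathbf{M}$. *)

(* Defs.v *)
From HB Require Import structures.
From mathcomp Require Import all_boot all_order all_algebra.
From mathcomp Require Import all_classical all_reals all_analysis.

Set Implicit Arguments.
Unset Strict Implicit.
Unset Printing Implicit Defensive.

Import Order.TTheory GRing.Theory Num.Theory.
Local Open Scope classical_set_scope.
Local Open Scope ring_scope.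

Notation bvec t := {ffun 'I_t -> bool}.

Lemma shift_pos_subproof t (r : 'I_t) (i : int) :
  (absz ((r%:Z + i) %% t%:Z)%Z < t)%N.
Proof.
have t_gt0 : 0 < t%:Z by rewrite ltz_nat; apply: leq_ltn_trans (ltn_ord r).
have := ltz_pmod (r%:Z + i) t_gt0.
by rewrite -{1}(gez0_abs (modz_ge0 _ (lt0r_neq0 t_gt0))) ltz_nat.
Qed.

Definition shift_pos t (r : 'I_t) (i : int) : 'I_t :=
  Ordinal (shift_pos_subproof r i).

Definition cshift t (x : bvec t) (i : int) : bvec t :=
  [ffun r => x (shift_pos r i)].

Definition shifts t (x : bvec t) : set (bvec t) := range (cshift x).

Definition vor t (x y : bvec t) : bvec t := [ffun r => x r || y r].
Definition vand t (x y : bvec t) : bvec t := [ffun r => x r && y r].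

(* The number of ones of the subvector of x on positions a, ..., b. *)
Definition weight_in t (x : bvec t) (a b : nat) : nat :=
  #|[pred r : 'I_t | [&& (a <= r)%N, (r <= b)%N & x r]]|.

Definition codeword t n (M : 'M[bool]_(t, n)) (j : 'I_n) : bvec t :=
  [ffun r => M r j].

Definition vor_family t n (A : {set 'I_n}) (z : 'I_n -> bvec t) : bvec t :=
  [ffun r => [exists m in A, z m r]].

(* The vectors are indexed by A, so that equal codewords at different indices
   are shifted independently of each other. *)
Definition shifts_or t n (A : {set 'I_n}) (y : 'I_n -> bvec t) : set (bvec t) :=
  [set vor_family A z | z in [set z | forall m, m \in A -> shifts (y m) (z m)]].

Definition slipped t (z : bvec t) : bvec t :=
  vor (vor (cshift z (-1)) z) (cshift z 1).

Definition URSC (R : realType) t n (alpha : R) (tau : nat -> nat -> nat)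
    (M : 'M[bool]_(t, n)) : Prop :=
  [/\ (n <= t)%N,
      forall k, (2 <= k <= n)%N -> (tau n k < t)%N
    & forall (k : nat) (T : {set 'I_n}) (j : 'I_n) (z : bvec t),
        (2 <= k <= n)%N -> #|T| = k -> j \in T ->
        shifts_or (T :\ j) (codeword M) z ->
        (weight_in (vand (codeword M j) (slipped z)) 0 (tau n k))%:R
          < alpha * (weight_in (codeword M j) 0 (tau n k))%:R].

Definition weight_ineq (R : realType) (alpha : R) t (x : bvec t)
    (a b : nat) : Prop :=
  (weight_in x 0 a)%:R <= alpha * (weight_in x a b)%:R.

(* The floor is an integer: it is -1 when alpha times the weight is < 1. *)
Definition collision_ineq (R : realType) (alpha : R) t (x y : bvec t)
    (k : nat) (i : int) (a b : nat) : Prop :=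
  (weight_in
     (vand x (vor (vor (cshift y (i - 1)) (cshift y i)) (cshift y (i + 1))))
     a b)%:Z
  <= Num.floor ((alpha * (weight_in x a b)%:R - 1) / k.-1%:R).

Definition collision_bound (R : realType) t n (alpha : R)
    (tau1 tau2 : nat -> nat -> nat) (M : 'M[bool]_(t, n)) : Prop :=
  forall k, (1 < k <= n)%N ->
  forall j j' : 'I_n, j != j' ->
  forall i : 'I_t,
    weight_ineq alpha (codeword M j) (tau1 n k) (tau2 n k) /\
    collision_ineq alpha (codeword M j) (codeword M j') k (i : nat)%:Z
      (tau1 n k) (tau2 n k).

Section Thresholds.
Variables (R : realType) (eps c : R).

(* Rounding: real thresholds are rounded down, and one row is added so that
   the last position tau2 n n exists. *)
Definition tau1 (n k : nat) : nat :=
  Num.truncn (c / 64%:R * k%:R ^+ 2 * ln n%:R).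

Definition tau2 (alpha : R) (n k : nat) : nat :=
  Num.truncn (c * (k%:R ^+ 2 / alpha `^ (2%:R + eps)) * ln n%:R).

Definition nrows (alpha : R) (n : nat) : nat :=
  (Num.truncn (c / alpha `^ (2%:R + eps) * n%:R ^+ 2 * ln n%:R)).+1.

End Thresholds.

Definition prob_one (R : realType) (n r : nat) : R :=
  (Num.sqrt (Num.truncn (r%:R / ln n%:R : R)).+1%:R)^-1.

Definition mutually_independent d (Omega : measurableType d) (R : realType)
    (P : probability Omega R) (I : eqType) (E : I -> set Omega) : Prop :=
  forall s : seq I, uniq s ->
    P (\bigcap_(i in [set i | i \in s]) E i) = (\prod_(i <- s) P (E i))%E.

(* Independent copies X 0, X 1, ... of the random t x n matrix: all the entries
   of all the copies are mutually independent. *)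
Definition random_matrices d (Omega : measurableType d) (R : realType)
    (P : probability Omega R) t n
    (X : nat -> Omega -> 'M[bool]_(t, n)) : Prop :=
  let one (e : nat * ('I_t * 'I_n)) : set Omega :=
    [set w | X e.1 w e.2.1 e.2.2] in
  [/\ forall e, measurable (one e),
      forall e, P (one e) = (prob_one R n e.2.1)%:E
    & mutually_independent P one].

(* A computation is its result together with the number of steps taken.  One
   step is: sampling or reading a matrix entry, or a bounded number of
   arithmetic operations, roundings and comparisons on numbers. *)
Definition timed (A : Type) : Type := (A * nat)%type.

Definition step A (x : A) : timed A := (x, 1%N).

Definition bind A B (x : timed A) (f : A -> timed B) : timed B :=
  ((f x.1).1, (x.2 + (f x.1).2)%N).

Notation "'let*' x := e 'in' f" := (bind e (fun x => f))
  (at level 200, x name, e at level 100, f at level 200).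

Fixpoint all_steps I (s : seq I) (f : I -> timed bool) : timed bool :=
  if s is x :: s' then
    let* b := f x in
    let* b' := all_steps s' f in
    step (b && b')
  else step true.

Fixpoint count_steps I (s : seq I) (f : I -> timed bool) : timed nat :=
  if s is x :: s' then
    let* b := f x in
    let* m := count_steps s' f in
    step (b + m)%N
  else step 0%N.

Section Algorithm.
Variables (R : realType) (t n : nat) (alpha : R).
Variables (tau1 tau2 : nat -> nat -> nat).
Implicit Type M : 'M[bool]_(t, n).

Definition count_rows (a b : nat) (f : 'I_t -> timed bool) : timed nat :=
  count_steps (enum 'I_t) (fun r : 'I_t =>
    let* inab := step (a <= r <= b)%N in
    let* x := f r in
    step (inab && x)).

Definition read M (j : 'I_n) (r : 'I_t) : timed bool := step (M r j).

Definition read_shifted M (j : 'I_n) (i : int) (r : 'I_t) : timed bool :=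
  let* q := step (shift_pos r i) in read M j q.

Definition read_collision M (j j' : 'I_n) (i : int) (r : 'I_t) : timed bool :=
  let* x := read M j r in
  let* y0 := read_shifted M j' (i - 1) r in
  let* y1 := read_shifted M j' i r in
  let* y2 := read_shifted M j' (i + 1) r in
  step (x && (y0 || y1 || y2)).

Definition check_pair M (k : nat) (j j' : 'I_n) (i : 'I_t) : timed bool :=
  let* a := step (tau1 n k) in
  let* b := step (tau2 n k) in
  let* w1 := count_rows 0 a (read M j) in
  let* w2 := count_rows a b (read M j) in
  let* w3 := count_rows a b (read_collision M j j' (i : nat)%:Z) in
  let* weight_ok := step ((w1%:R : R) <= alpha * w2%:R) in
  let* collision_ok :=
    step (w3%:Z <= Num.floor ((alpha * w2%:R - 1) / k.-1%:R)) in
  step ((j == j') || (weight_ok && collision_ok)).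

Definition check M : timed bool :=
  all_steps (iota 2 n.-1) (fun k =>
    all_steps (enum 'I_n) (fun j =>
      all_steps (enum 'I_n) (fun j' =>
        all_steps (enum 'I_t) (fun i => check_pair M k j j' i)))).

Definition generate M : timed 'M[bool]_(t, n) := (M, (t * n)%N).

Definition attempt M : timed bool := let* M' := generate M in check M'.

(* [runs X m M T]: the loop, entered when the next fresh random matrix is X m,
   stops after exactly T steps and outputs M. *)
Inductive runs (X : nat -> 'M[bool]_(t, n)) :
    nat -> 'M[bool]_(t, n) -> nat -> Prop :=
  | runs_stop m : (attempt (X m)).1 -> runs X m (X m) (attempt (X m)).2
  | runs_retry m M T : ~~ (attempt (X m)).1 -> runs X m.+1 M T ->
      runs X m M ((attempt (X m)).2 + T)%N.

Definition outputs (X : nat -> 'M[bool]_(t, n)) (M : 'M[bool]_(t, n))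
  (T : nat) : Prop := runs X 0 M T.

(* +oo when the loop does not stop. *)
Definition runtime (X : nat -> 'M[bool]_(t, n)) : \bar R :=
  ereal_inf [set (T%:R)%:E | T in [set T | exists M, outputs X M T]].

Lemma all_stepsE I (s : seq I) f : (all_steps s f).1 = all (fun x => (f x).1) s.
Proof. by elim: s => //= x s ->. Qed.

Lemma count_rowsE a b f (x : bvec t) :
  (forall r, (f r).1 = x r) -> (count_rows a b f).1 = weight_in x a b.
Proof.
move=> fx; have countE I (s : seq I) g :
    (count_steps s g).1 = count (fun y => (g y).1) s.
  by elim: s => //= y s ->.
rewrite countE /weight_in cardE size_filter enumT.
by apply: eq_count => r /=; rewrite fx -andbA.
Qed.

Lemma attemptP M :
  reflect (collision_bound alpha tau1 tau2 M) (attempt M).1.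
Proof.
have pairP k (j j' : 'I_n) (i : 'I_t) : reflect (j != j' ->
    weight_ineq alpha (codeword M j) (tau1 n k) (tau2 n k) /\
    collision_ineq alpha (codeword M j) (codeword M j') k (i : nat)%:Z
      (tau1 n k) (tau2 n k)) (check_pair M k j j' i).1.
  have readE r : (read M j r).1 = codeword M j r by rewrite ffunE.
  have collE r : (read_collision M j j' (i : nat)%:Z r).1 =
      vand (codeword M j) (vor (vor
        (cshift (codeword M j') ((i : nat)%:Z - 1))
        (cshift (codeword M j') (i : nat)%:Z))
        (cshift (codeword M j') ((i : nat)%:Z + 1))) r by rewrite !ffunE.
  rewrite /check_pair /bind /step.
  cbn [fst snd].
  rewrite !(count_rowsE _ _ readE) (count_rowsE _ _ collE).
  case: eqP => [jj'|jj'] /=; first by constructor.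
  apply: (iffP andP) => [[] //|]; exact.
rewrite /= all_stepsE; apply: (iffP allP) => [H k kn j j' jj' i|H k].
  have /H : k \in iota 2 n.-1.
    by rewrite mem_iota; case: (n) kn => [|n']; rewrite ?addnS //; case: k => [|[]].
  rewrite all_stepsE => /allP/(_ j (mem_enum _ _)).
  rewrite all_stepsE => /allP/(_ j' (mem_enum _ _)).
  by rewrite all_stepsE => /allP/(_ i (mem_enum _ _))/pairP; exact.
rewrite mem_iota => kn; have {}kn : (1 < k <= n)%N.
  by case: (n) kn => [|n'] /=; rewrite ?addnS //; case: k => [|[]].
rewrite all_stepsE; apply/allP => j _; rewrite all_stepsE; apply/allP => j' _.
rewrite all_stepsE; apply/allP => i _; apply/pairP => jj'; exact: H.
Qed.

End Algorithm.

(* Main.v *)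
(* A random matrix satisfies the Collision Bound Property with probability at
   least 1 - n^(-b), whatever alpha is.  Write L = ln n.  Then
   sum_(r <= x) p(r) is about 2 sqrt(L x), so the weight of a column on
   [0, tau1] and on [tau1, tau2] has mean of order k sqrt(c) L and
   k sqrt(c) L / a^(1 + eps/2) (with a = alpha/2), whereas the number of
   collisions with a shifted column has mean O(L (1 + ln(1/a))), because
   p(r)p(r') behaves like L / max(r, r') away from the first tau1 rows.  The
   number of collisions that the property allows is of order
   sqrt(c) L / a^(eps/2), which dominates this mean for c large.  Chernoff
   bounds then make every single failure have probability
   exp(- Omega(sqrt(c) L / a^(eps/2))), and this beats the number of quadruples
   (k, j, j', i), which is polynomial in n and in 1/a.

   Each attempt has the same cost, whether it succeeds or not, and the attempts
   are independent, so that the running time is geometric.  Finally the Weight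
   Inequality pays for [0, tau1] and the Collision Weight Inequality for
   [tau1, tau2], each with alpha/2, which gives an (n, alpha)-URSC. *)
Require Import Defs.
From HB Require Import structures.
From mathcomp Require Import all_boot all_order all_algebra.
From mathcomp Require Import all_classical all_reals all_analysis.
From mathcomp Require Import measurable_realfun.
From mathcomp Require Import ring lra zify.

Set Implicit Arguments.
Unset Strict Implicit.
Unset Printing Implicit Defensive.

Import Order.TTheory GRing.Theory Num.Theory.
Local Open Scope classical_set_scope.
Local Open Scope ring_scope.

(** * From the Collision Bound Property to resilience *)

Lemma shift_posD t (r : 'I_t) (i i' : int) :
  shift_pos (shift_pos r i) i' = shift_pos r (i + i').
Proof.
have t_neq0 : t%:Z != 0.
  by apply: lt0r_neq0; rewrite ltz_nat (leq_ltn_trans _ (ltn_ord r)).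
apply: val_inj => /=; congr absz.
by rewrite gez0_abs ?modz_ge0 // modzDml addrA.
Qed.

Lemma shift_pos0 t (r : 'I_t) : shift_pos r 0 = r.
Proof. by apply: val_inj; rewrite /= addr0 modz_small //= ltz_nat ltn_ord. Qed.

Lemma shift_pos_inj t (i : int) : injective (fun r : 'I_t => shift_pos r i).
Proof.
apply: (can_inj (g := fun r => shift_pos r (- i))) => r.
by rewrite shift_posD subrr shift_pos0.
Qed.

Lemma cshiftD t (x : bvec t) (i i' : int) :
  cshift (cshift x i) i' = cshift x (i + i').
Proof. by apply/ffunP => r; rewrite !ffunE shift_posD addrC. Qed.

(** Codewords are shifted by arbitrary integers, whereas [collision_bound] ranges over ['I_t]; the
    residue of [i] is where position 0 lands. The offset [e] lets three neighbouring shifts share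
    one residue. *)
Lemma cshift_ord t (i : int) : (0 < t)%N ->
  exists i0 : 'I_t, forall (x : bvec t) (e : int),
    cshift x (i + e) = cshift x (i0%:Z + e).
Proof.
case: t => // t _; exists (shift_pos ord0 i) => x e.
rewrite -!cshiftD; congr cshift; apply/ffunP => r; rewrite !ffunE; congr (x _).
apply: val_inj => /=; congr absz.
by rewrite gez0_abs ?modz_ge0 // modzDmr add0r.
Qed.

Definition spread t (x : bvec t) (i : int) : bvec t :=
  vor (vor (cshift x (i - 1)) (cshift x i)) (cshift x (i + 1)).

Lemma spread_ord t (x : bvec t) (i : int) : (0 < t)%N ->
  exists i0 : 'I_t, spread x i = spread x (i0 : nat)%:Z.
Proof.
move=> /(cshift_ord i) [i0 i0E]; exists i0; rewrite /spread.
by have := i0E x 0; rewrite !addr0 !i0E => ->.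
Qed.

(** Slipping commutes with shifts and distributes over OR, so each one of the slipped vector comes
    from some spread column. The shifts are fixed before [r], so one family serves all positions. *)
Lemma slipped_vor_family t n (M : 'M[bool]_(t, n)) (A : {set 'I_n}) z :
  (0 < t)%N -> shifts_or A (codeword M) z ->
  exists i : 'I_n -> 'I_t, forall r, slipped z r ->
    exists2 m, m \in A & spread (codeword M m) (i m : nat)%:Z r.
Proof.
move=> t_gt0 [y yA <-].
have /choice[i iP] : forall m, exists i : 'I_t,
    m \in A -> slipped (y m) = spread (codeword M m) (i : nat)%:Z.
  move=> m; have [mA|mA] := boolP (m \in A); last by exists (Ordinal t_gt0).
  have [i _ <-] := yA m mA; have [i0 i0E] := spread_ord (codeword M m) i t_gt0.
  by exists i0 => _; rewrite -i0E /slipped !cshiftD.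
exists i => r slip.
have [m mA slm] : exists2 m, m \in A & slipped (y m) r.
  move: slip; rewrite !ffunE => /orP[/orP[]|] /exists_inP[m mA ymr];
    exists m => //; rewrite !ffunE ymr ?orbT //.
by exists m => //; rewrite -iP.
Qed.

Lemma weight_inE t (x : bvec t) a b :
  weight_in x a b = (\sum_(r < t) [&& a <= r, r <= b & x r])%N.
Proof. by rewrite /weight_in -sum1_card big_mkcond. Qed.

Lemma weight_in_widen t (x : bvec t) a b :
  (weight_in x a b <= weight_in x 0 b)%N.
Proof.
by apply: subset_leq_card; apply/fintype.subsetP => r /and3P[_ rb xr]; apply/and3P.
Qed.

Lemma collision_bound_URSC (R : realType) t n (alpha : R) (t1 t2 : nat -> nat -> nat)
    (M : 'M[bool]_(t, n)) :
  0 < alpha -> (n <= t)%N -> (forall k, (2 <= k <= n)%N -> (t2 n k < t)%N) ->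
  collision_bound (alpha / 2%:R) t1 t2 M -> URSC alpha t2 M.
Proof.
move=> alpha_gt0 nt t2t CB; split=> // k T j z kn Tk jT zT.
have t_gt0 : (0 < t)%N.
  by case/andP: kn => k2 kn; apply: leq_trans (leq_trans (ltnW k2) kn) nt.
set x := codeword M j; set a := t1 n k; set b := t2 n k.
have k_gt0 : (0 < k.-1)%N by case: (k) kn => [|[]].
have cardA : #|T :\ j| = k.-1 by rewrite -Tk (cardsD1 j T) jT.
pose W := weight_in x a b.
pose col (m : 'I_n) (i : 'I_t) := weight_in (vand x (spread (codeword M m) (i : nat)%:Z)) a b.
have colW m i : m != j -> (col m i)%:R <= (alpha / 2%:R * W%:R - 1) / k.-1%:R.
  rewrite eq_sym => jm; have [_] := CB k kn j m jm i.
  by rewrite /collision_ineq floor_ge_int.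
(* The Weight Inequality is reached only through a pair of distinct columns; [k >= 2] provides a
   partner for [j]. *)
have vW : (weight_in x 0 a)%:R <= alpha / 2%:R * W%:R.
  have : (0 < #|T :\ j|)%N by rewrite cardA.
  case/card_gt0P => m; rewrite !inE => /andP[mj _].
  have i : 'I_t := Ordinal t_gt0.
  by rewrite eq_sym in mj; have [] := CB k kn j m mj i.
have [i spreadi] := slipped_vor_family t_gt0 zT.
(* Positions up to [a] are charged to the prefix weight, each later one to a column that covers
   it. *)
have split_weight : (weight_in (vand x (slipped z)) 0 b <=
    weight_in x 0 a + \sum_(m in T :\ j) col m (i m))%N.
  rewrite !weight_inE; under [X in (_ + X)%N]eq_bigr do rewrite /col weight_inE.
  rewrite exchange_big -big_split /=; apply: leq_sum => r _.
  rewrite ffunE; case: (boolP [&& (r <= b)%N, x r & slipped z r]) => [/and3P[rb xr zr]|//].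
  rewrite xr; case: (leqP r a) => [//|/ltnW ar].
  have [m mT sm] := spreadi r zr.
  by rewrite (bigD1 m) //= ffunE xr sm ar rb addnA leq_addr.
have : (weight_in (vand x (slipped z)) 0 b)%:R <=
    alpha / 2%:R * W%:R + (k.-1)%:R * ((alpha / 2%:R * W%:R - 1) / k.-1%:R).
  apply: le_trans (_ : (weight_in x 0 a + \sum_(m in T :\ j) col m (i m))%N%:R <= _).
    by rewrite ler_nat.
  rewrite natrD natr_sum lerD // -cardA mulr_natl -sumr_const ler_sum // cardA.
  by move=> m; rewrite !inE => /andP[mj _]; apply: colW.
(* The bound is now alpha W - 1: the -1 inside the floor is what makes the resilience inequality
   strict. *)
rewrite mulrCA divff ?pnatr_eq0 -?lt0n // mulr1 => H.
apply: le_lt_trans H _.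
have : alpha * W%:R <= alpha * (weight_in x 0 b)%:R.
  by rewrite ler_wpM2l ?(ltW alpha_gt0) // ler_nat weight_in_widen.
lra.
Qed.

(** * Chernoff bounds on finite probability spaces *)

(* [Z o] is a random subset of [Q] that contains each [r] independently with
   probability [pi r].  Expanding (1 + x)^|Z| over the subsets of Z, its mean
   only involves the probabilities of the events [B \subset Z]. *)
Section IndependentMarks.
Variables (R : realType) (O J : finType) (mu : O -> R) (pi : J -> R).
Variables (Q : {set J}) (Z : O -> {set J}).
Hypothesis mu_ge0 : forall o, 0 <= mu o.
Hypothesis ZQ : forall o, Z o \subset Q.
Hypothesis indep : forall B : {set J}, B \subset Q ->
  \sum_(o | B \subset Z o) mu o = \prod_(r in B) pi r.

Lemma marks_mgf (x : R) :
  \sum_o mu o * (1 + x) ^+ #|Z o| = \prod_(r in Q) (1 + x * pi r).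
Proof.
have expand (F : J -> R) : \prod_(r in Q) (1 + F r) =
    \sum_(B : {set J} | B \subset Q) \prod_(r in B) F r.
  transitivity (\prod_r ((if r \in Q then F r else 0) + 1)).
    by rewrite big_mkcond; apply: eq_bigr => r _; case: ifP; rewrite ?add0r // addrC.
  rewrite bigA_distr [RHS]big_mkcond /=; apply: eq_bigr => B _.
  rewrite -big_mkcond /=; case: ifP => [/fintype.subsetP BQ|/negbT/fintype.subsetPn[r rB rQ]].
    by apply: eq_bigr => r /BQ ->.
  by rewrite (bigD1 r) //= (negbTE rQ) mul0r.
have ZE o : (1 + x) ^+ #|Z o| =
    \sum_(B : {set J} | B \subset Q) (if B \subset Z o then x ^+ #|B| else 0).
  transitivity (\prod_(r in Q) (1 + (if r \in Z o then x else 0))).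
    rewrite -prodr_const [RHS](big_setID (Z o)) /= [X in _ * X]big1 ?mulr1.
      rewrite (finset.setIidPr (ZQ o)); apply: eq_bigr => r -> //.
    by move=> r; rewrite !inE => /andP[/negbTE -> _]; rewrite addr0.
  rewrite expand; apply: eq_bigr => B _.
  case: ifP => [/fintype.subsetP BZ|/negbT/fintype.subsetPn[r rB rZ]].
    by rewrite -prodr_const; apply: eq_bigr => r /BZ ->.
  by rewrite (bigD1 r) //= (negbTE rZ) mul0r.
transitivity (\sum_o \sum_(B : {set J} | B \subset Q)
    mu o * (if B \subset Z o then x ^+ #|B| else 0)).
  by apply: eq_bigr => o _; rewrite ZE big_distrr.
rewrite expand exchange_big /=; apply: eq_bigr => B BQ.
rewrite big_split /= prodr_const -indep // big_distrr [RHS]big_mkcond /=.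
by apply: eq_bigr => o _; case: ifP; rewrite ?mulr0 // mulrC.
Qed.

(** Each factor is bounded by 1 + u <= exp(u); [-1 <= x] keeps the factors nonnegative, so that the
    bounds multiply. *)
Lemma marks_mgf_le (x : R) : -1 <= x -> (forall r, 0 <= pi r <= 1) ->
  \sum_o mu o * (1 + x) ^+ #|Z o| <= expR (x * \sum_(r in Q) pi r).
Proof.
move=> x_ge pi01; rewrite marks_mgf mulr_sumr expR_sum; apply: ler_prod => r _.
rewrite expR_ge1Dx andbT; have /andP[p0 p1] := pi01 r.
nra.
Qed.

(** Markov's inequality at x = 1: the mean of 2^|Z| is at most exp(m), and 2 >= exp(1/2). *)
Lemma marks_upper_tail (m u : R) : (forall r, 0 <= pi r <= 1) ->
  \sum_(r in Q) pi r <= m ->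
  \sum_(o | u <= #|Z o|%:R) mu o <= expR (m - u / 2%:R).
Proof.
move=> pi01 pim.
have half : expR (2^-1 : R) <= 2.
  have := expR_ge1Dx (- 2^-1 : R); rewrite expRN => h.
  have : (1 + - 2^-1) * expR 2^-1 <= (expR 2^-1)^-1 * expR (2^-1 : R).
    by rewrite ler_wpM2r ?expR_ge0.
  rewrite mulVf ?expR_eq0 //; lra.
rewrite expRB ler_pdivlMr ?expR_gt0 // mulr_suml.
apply: (@le_trans _ _ (\sum_o mu o * (1 + 1) ^+ #|Z o|)); last first.
  apply: le_trans (marks_mgf_le _ pi01) _; first by lra.
  by rewrite mul1r ler_expR.
rewrite [leRHS](bigID (fun o => u <= #|Z o|%:R)) /=.
rewrite -[leLHS]addr0 lerD //; last first.
  by apply: sumr_ge0 => o _; rewrite mulr_ge0 ?exprn_ge0 //; lra.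
apply: ler_sum => o uZ; rewrite ler_wpM2l //.
apply: (@le_trans _ _ (expR 2^-1 ^+ #|Z o|)).
  rewrite -expRM_natr ler_expR; lra.
by rewrite lerXn2r ?nnegrE ?expR_ge0.
Qed.

(** Markov's inequality at x = -1/2: the mean of 2^(-|Z|) is at most exp(-m/2), and 1/2 >=
    exp(-1). *)
Lemma marks_lower_tail (m u : R) : (forall r, 0 <= pi r <= 1) ->
  m <= \sum_(r in Q) pi r ->
  \sum_(o | #|Z o|%:R <= u) mu o <= expR (u - m / 2%:R).
Proof.
move=> pi01 pim.
rewrite addrC expRD -ler_pdivrMr ?expR_gt0 // -expRN mulr_suml.
apply: (@le_trans _ _ (\sum_o mu o * (1 + - 2^-1) ^+ #|Z o|)); last first.
  apply: le_trans (marks_mgf_le _ pi01) _; first by lra.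
  by rewrite ler_expR; lra.
rewrite [leRHS](bigID (fun o => #|Z o|%:R <= u)) /=.
rewrite -[leLHS]addr0 lerD //; last first.
  by apply: sumr_ge0 => o _; rewrite mulr_ge0 ?exprn_ge0 //; lra.
apply: ler_sum => o uZ; rewrite ler_wpM2l //.
apply: (@le_trans _ _ (expR (-1) ^+ #|Z o|)).
  rewrite -expRM_natr ler_expR; lra.
rewrite lerXn2r ?nnegrE ?expR_ge0 //; first by lra.
have := expR_ge1Dx (1 : R) => h.
rewrite expRN (_ : 1 + - 2^-1 = 2^-1); last by lra.
by rewrite lef_pV2 ?posrE ?expR_gt0.
Qed.

End IndependentMarks.

Section Bernoulli.
Variables (R : realType) (I : finType) (p : I -> R).

Definition bernoulli_mass (f : {ffun I -> bool}) : R :=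
  \prod_i (if f i then p i else 1 - p i).

Lemma bernoulli_mass_ge0 f : (forall i, 0 <= p i <= 1) -> 0 <= bernoulli_mass f.
Proof.
move=> p01; apply: prodr_ge0 => i _; have /andP[p0 p1] := p01 i.
by case: ifP; rewrite ?subr_ge0.
Qed.

Lemma bernoulli_mass_all_ones (U : {set I}) :
  \sum_(f : {ffun I -> bool} | U \subset [pred i | f i]) bernoulli_mass f =
  \prod_(i in U) p i.
Proof.
(* Giving weight 0 to [false] on [U] absorbs the constraint into the product, and the sum over all
   [f] then factors over coordinates. *)
pose F i (b : bool) := if b then p i else if i \in U then 0 else 1 - p i.
transitivity (\prod_i \sum_(b : bool) F i b); last first.
  rewrite [RHS]big_mkcond; apply: eq_bigr => i _; rewrite big_bool /F /=.
  by case: ifP => _; rewrite ?addr0 // addrC subrK.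
rewrite bigA_distr_bigA big_mkcond; apply: eq_bigr => f _.
case: ifP => [/fintype.subsetP fU|/negbT/fintype.subsetPn[i iU]].
  apply: eq_bigr => i _; rewrite /F; case: ifP => // fi; case: ifP => // /fU.
  by rewrite inE fi.
by rewrite inE => fi; rewrite (bigD1 i) //= /F (negbTE fi) iU mul0r.
Qed.

End Bernoulli.

(** * Sums of the entry probabilities *)

Section EntryProbability.
Variables (R : realType) (n : nat).
Hypothesis n_ge2 : (2 <= n)%N.
Let L : R := ln n%:R.
Let p (r : nat) : R := prob_one R n r.

Lemma ln2_ge : 2^-1 <= ln (2 : R).
Proof.
have := @le_ln1Dx R (- 2^-1); rewrite (_ : 1 + - 2^-1 = 2^-1); last by lra.
by rewrite lnV ?posrE //; lra.
Qed.

Lemma ln_nat_ge : 2^-1 <= L.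
Proof. by apply: le_trans ln2_ge _; rewrite ler_ln ?posrE ?ltr0n ?ler_nat // ltnW. Qed.

Let L_gt0 : 0 < L. Proof. have := ln_nat_ge; lra. Qed.

Lemma prob_one_gt0 r : 0 < p r.
Proof. by rewrite invr_gt0 sqrtr_gt0 ltr0n. Qed.

Lemma prob_one_le1 r : p r <= 1.
Proof. by rewrite invf_le1 ?sqrtr_gt0 ?ltr0n // -[X in X <= _]sqrtr1 ler_sqrt ?ler1n. Qed.

Lemma prob_one_le r r' : (r <= r')%N -> p r' <= p r.
Proof.
move=> rr'; rewrite lef_pV2 ?posrE ?sqrtr_gt0 ?ltr0n // ler_sqrt ?ler_nat ?ltr0n //.
by rewrite ltnS le_truncn // ler_wpM2r ?invr_ge0 ?ler_nat // ltW.
Qed.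

(** Here and in [prob_one_lower] the floor is removed by r/L < floor(r/L) + 1 <= (r + L)/L. Position
    0 is excluded because division by 0 yields 0. *)
Lemma prob_one_upper r : (0 < r)%N -> p r <= Num.sqrt (L / r%:R).
Proof.
move=> r_gt0; rewrite /p /prob_one -sqrtrV ?ler0n // ler_sqrt; last first.
  by rewrite divr_ge0 ?(ltW L_gt0).
rewrite -[L / _]invf_div lef_pV2 ?posrE ?ltr0n //; first exact/ltW/truncnS_gt.
by rewrite divr_gt0 ?ltr0n.
Qed.

Lemma prob_one_lower r : Num.sqrt (L / (r%:R + L)) <= p r.
Proof.
rewrite /p /prob_one -sqrtrV ?ler0n // ler_sqrt ?invr_ge0 ?ler0n //.
rewrite -[L / _]invf_div lef_pV2 ?posrE ?ltr0n //; last first.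
  by rewrite divr_gt0 // ltr_wpDl.
rewrite mulrDl divff ?gt_eqF // -natr1 lerD2r.
by rewrite truncn_le divr_ge0 // ltW.
Qed.

(** This bound and the next replace the comparison of a sum of 1/sqrt(x) with its integral: 2
    sqrt(x) telescopes. *)
Lemma sqrt_natS_upper (x : R) : 0 <= x ->
  (Num.sqrt (x + 1))^-1 <= 2%:R * (Num.sqrt (x + 1) - Num.sqrt x).
Proof.
move=> x_ge0; set u := Num.sqrt (x + 1); set v := Num.sqrt x.
have u_gt0 : 0 < u by rewrite sqrtr_gt0; lra.
have v_ge0 : 0 <= v := sqrtr_ge0 _.
have uu : u * u = x + 1 by rewrite -expr2 sqr_sqrtr //; lra.
have vv : v * v = x by rewrite -expr2 sqr_sqrtr.
rewrite -[u^-1]mul1r ler_pdivrMr //; nra.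
Qed.

Lemma sqrt_natS_lower (x : R) : 0 < x ->
  2%:R * (Num.sqrt (x + 1) - Num.sqrt x) <= (Num.sqrt x)^-1.
Proof.
move=> x_gt0; set u := Num.sqrt (x + 1); set v := Num.sqrt x.
have v_gt0 : 0 < v by rewrite sqrtr_gt0.
have u_ge0 : 0 <= u := sqrtr_ge0 _.
have uu : u * u = x + 1 by rewrite -expr2 sqr_sqrtr //; lra.
have vv : v * v = x by rewrite -expr2 sqr_sqrtr // ltW.
rewrite -[v^-1]mul1r ler_pdivlMr //; nra.
Qed.

Lemma sum_prob_one_upper m :
  \sum_(0 <= r < m.+1) p r <= 1 + 2%:R * Num.sqrt L * Num.sqrt m%:R.
Proof.
elim: m => [|m IH]; first by rewrite big_nat1 sqrtr0 mulr0 addr0 prob_one_le1.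
rewrite big_nat_recr //=.
have := prob_one_upper (ltn0Sn m); rewrite sqrtrM ?(ltW L_gt0) // sqrtrV ?ler0n //.
have := @sqrt_natS_upper m%:R (ler0n _ _); rewrite natr1 => h1 h2.
have h3 := ler_wpM2l (sqrtr_ge0 L) h1.
lra.
Qed.

Lemma sum_prob_one_lower a b : (a <= b)%N ->
  2%:R * Num.sqrt L * (Num.sqrt (b%:R + L) - Num.sqrt (a%:R + L)) <=
  \sum_(a <= r < b) p r.
Proof.
elim: b => [|b IH]; first by rewrite leqn0 => /eqP ->; rewrite subrr mulr0 big_geq.
rewrite leq_eqVlt => /orP[/eqP <-|]; first by rewrite subrr mulr0 big_geq.
rewrite ltnS => ab; rewrite big_nat_recr //=; have {}IH := IH ab.
have := prob_one_lower b; rewrite sqrtrM ?(ltW L_gt0) // sqrtrV ?addr_ge0 ?(ltW L_gt0) //.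
have := @sqrt_natS_lower (b%:R + L); rewrite -[b.+1%:R]natr1 ltr_wpDl // => /(_ isT) h1 h2.
have h3 := ler_wpM2l (sqrtr_ge0 L) h1.
rewrite [b%:R + 1 + L]addrAC; lra.
Qed.

(** Telescoping: ln(1 - u) <= -u at u = 1/(b+1) gives 1/(b+1) <= ln(b+1) - ln b. *)
Lemma sum_inv_upper a b : (0 < a <= b)%N ->
  \sum_(a <= r < b.+1) (r%:R^-1 : R) <= a%:R^-1 + ln (b%:R / a%:R).
Proof.
case/andP=> a_gt0; elim: b => [|b IH]; first by rewrite leqNgt a_gt0.
rewrite leq_eqVlt => /orP[/eqP <-|].
  by rewrite big_nat1 divff ?pnatr_eq0 -?lt0n // ln1 addr0.
rewrite ltnS => ab; have b_gt0 := leq_trans a_gt0 ab.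
rewrite big_nat_recr ?leqW //=; have {}IH := IH ab.
have := @le_ln1Dx R (- b.+1%:R^-1).
rewrite (_ : 1 + - b.+1%:R^-1 = b%:R / b.+1%:R); last first.
  by rewrite -natr1; field; rewrite natr1 pnatr_eq0.
rewrite !ln_div ?posrE ?ltr0n // in IH *.
rewrite ltrN2 invf_lt1 ?ltr0n // ltr1n ltnS b_gt0 => /(_ isT) h.
apply: le_trans (lerD IH (_ : _ <= ln b.+1%:R - ln b%:R)) _; last by lra.
by rewrite -[leRHS]opprB lerNr.
Qed.

Lemma sum_ord_itv t a b (F : nat -> R) : (b < t)%N ->
  \sum_(r < t | (a <= r <= b)%N) F r = \sum_(a <= r < b.+1) F r.
Proof.
move=> bt; rewrite (big_nat_widenl _ 0) // (big_nat_widen _ _ t) // big_mkord.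
by apply: eq_bigl => r; rewrite ltnS.
Qed.

Lemma sum_prob_one_sqr a b : (0 < a <= b)%N ->
  \sum_(a <= r < b.+1) p r ^+ 2 <= L * (a%:R^-1 + ln (b%:R / a%:R)).
Proof.
move=> ab; apply: le_trans (ler_wpM2l (ltW L_gt0) (sum_inv_upper ab)).
rewrite mulr_sumr big_nat_cond [leRHS]big_nat_cond; apply: ler_sum => r.
rewrite andbT => /andP[ar _]; have r_gt0 : (0 < r)%N by apply: leq_trans ar; case/andP: ab.
have := prob_one_upper r_gt0; have := prob_one_gt0 r => p_gt0 pU.
apply: le_trans (_ : Num.sqrt (L / r%:R) ^+ 2 <= _).
  by rewrite lerXn2r ?nnegrE ?sqrtr_ge0 // ltW.
by rewrite sqr_sqrtr // divr_ge0 // ltW.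
Qed.

(* Cells shifted before position [a] meet only entries of probability at most
   [p a]; elsewhere the product is at most the square of the larger factor. *)
Lemma sum_collision t a b (q : 'I_t -> 'I_t) : injective q ->
  (0 < a <= b)%N -> (b < t)%N ->
  \sum_(r < t | (a <= r <= b)%N) p r * p (q r) <=
  2%:R * (L * (a%:R^-1 + ln (b%:R / a%:R))) + (Num.sqrt (L / a%:R) + 2%:R * L).
Proof.
move=> q_inj ab bt; have [a_gt0 aleb] := andP ab.
(* [F (q r)] pays for the product whenever [q r < r]; otherwise [p r ^+ 2] does. *)
pose F (s : 'I_t) : R := (if (a <= s <= b)%N then p s ^+ 2 else 0) +
  (if (s < a)%N then p a * p s else 0).
have pp r : 0 <= p r by apply/ltW/prob_one_gt0.
have F_ge0 s : 0 <= F s.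
  by rewrite /F addr_ge0 //; case: ifP; rewrite ?sqr_ge0 ?mulr_ge0.
apply: (@le_trans _ _ (\sum_(r < t | (a <= r <= b)%N) (p r ^+ 2 + F (q r)))).
  apply: ler_sum => r /andP[ar rb]; rewrite /F.
  case: (ltnP (q r) a) => [qa|aq] /=.
    rewrite add0r ler_wpDl ?sqr_ge0 //.
    by rewrite ler_wpM2r // prob_one_le.
  case: (leqP (q r) r) => [qr|/ltnW rq].
    rewrite (leq_trans qr rb) addr0 ler_wpDl ?sqr_ge0 //.
    by rewrite ler_wpM2r // prob_one_le.
  rewrite addr0 ler_wpDr //; first by case: ifP; rewrite ?sqr_ge0.
  by rewrite ler_wpM2l // prob_one_le.
rewrite big_split /= (sum_ord_itv _ (fun r => p r ^+ 2)) //.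
(* Since [q] is a permutation of the positions, the terms [F (q r)] over the window are part of the
   full sum of [F]. *)
have FE : \sum_(r < t | (a <= r <= b)%N) F (q r) <= \sum_r F r.
  rewrite [leRHS](reindex_inj q_inj) /= [leRHS](bigID (fun r : 'I_t => (a <= r <= b)%N)) /=.
  by rewrite ler_wpDr // sumr_ge0.
have F2 : \sum_(r < t) F r <= L * (a%:R^-1 + ln (b%:R / a%:R)) +
    p a * (1 + 2%:R * Num.sqrt L * Num.sqrt a%:R).
  rewrite big_split /= -!big_mkcond /= (sum_ord_itv _ (fun r => p r ^+ 2)) //.
  rewrite lerD ?sum_prob_one_sqr // -mulr_sumr ler_wpM2l //.
  apply: le_trans (sum_prob_one_upper a).
  rewrite -(sum_ord_itv 0 p (leq_ltn_trans aleb bt)) [leRHS]big_mkcond /=.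
  rewrite big_mkcond; apply: ler_sum => r _.
  by case: ifP => [/ltnW -> //|_]; case: ifP.
have pa := prob_one_upper a_gt0.
(* The head contributes p(a) times about 2 sqrt(L a), and p(a) <= sqrt(L/a): the dependence on [a]
   cancels and leaves 2 L. *)
have paE : Num.sqrt (L / a%:R) * (Num.sqrt L * Num.sqrt a%:R) = L.
  rewrite mulrA mulrAC -sqrtrM ?divr_ge0 ?(ltW L_gt0) //.
  by rewrite divfK ?pnatr_eq0 -?lt0n // -expr2 sqr_sqrtr ?ltW.
have u_ge0 : 0 <= 1 + 2%:R * Num.sqrt L * Num.sqrt a%:R.
  by rewrite addr_ge0 ?mulr_ge0 ?sqrtr_ge0.
have pau := ler_wpM2r u_ge0 pa.
have uE : Num.sqrt (L / a%:R) * (1 + 2%:R * Num.sqrt L * Num.sqrt a%:R) =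
    Num.sqrt (L / a%:R) + 2%:R * L.
  by rewrite -mulrA mulrDr mulr1 mulrCA paE.
rewrite uE in pau.
apply: le_trans (lerD (sum_prob_one_sqr ab) (le_trans FE (le_trans F2 (lerD (lexx _) pau)))) _.
by rewrite addrA [2%:R * (L * _)]mulr_natl mulr2n.
Qed.

End EntryProbability.

(** * Tails of weights and collisions *)

Section MatrixTails.
Variables (R : realType) (t n : nat).
Notation cell := ('I_t * 'I_n)%type.
Let p (e : cell) : R := prob_one R n e.1.

Definition grid_mx (f : {ffun cell -> bool}) : 'M[bool]_(t, n) :=
  \matrix_(r, j) f (r, j).

Let p01 e : 0 <= p e <= 1.
Proof. by rewrite /p ltW ?prob_one_gt0 // prob_one_le1. Qed.

Let mass_ge0 f : 0 <= bernoulli_mass p f.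
Proof. exact: bernoulli_mass_ge0. Qed.

Section Column.
Variables (j : 'I_n) (a b : nat).
Let Q : {set 'I_t} := finset (fun r : 'I_t => (a <= r <= b)%N).
Let Z (f : {ffun cell -> bool}) : {set 'I_t} :=
  finset (fun r : 'I_t => (r \in Q) && f (r, j)).

Let ZQ f : Z f \subset Q.
Proof. by apply/fintype.subsetP => r; rewrite !inE => /andP[]. Qed.

Let card_Z f : #|Z f| = weight_in (codeword (grid_mx f) j) a b.
Proof.
by apply: eq_card => r; rewrite !inE ffunE mxE -andbA.
Qed.

Let indep (B : {set 'I_t}) : B \subset Q ->
  \sum_(f | B \subset Z f) bernoulli_mass p f = \prod_(r in B) p (r, j).
Proof.
move=> /fintype.subsetP BQ; pose g (r : 'I_t) : cell := (r, j).
have g_inj : injective g by move=> r r' [].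
rewrite -(big_imset p (h := g)) /=; last by move=> r r' _ _; apply: g_inj.
rewrite -bernoulli_mass_all_ones; apply: eq_bigl => f.
apply/fintype.subsetP/fintype.subsetP => H.
  by move=> _ /imsetP[r /H + ->]; rewrite !inE => /andP[].
by move=> r rB; have := H _ (imset_f g rB); have := BQ _ rB; rewrite !inE => -> ->.
Qed.

Let sumQ (F : 'I_t -> R) : \sum_(r in Q) F r = \sum_(r < t | (a <= r <= b)%N) F r.
Proof. by apply: eq_bigl => r; rewrite inE. Qed.

Lemma weight_upper_tail (m u : R) :
  \sum_(r < t | (a <= r <= b)%N) prob_one R n r <= m ->
  \sum_(f | u <= (weight_in (codeword (grid_mx f) j) a b)%:R) bernoulli_mass p f
    <= expR (m - u / 2%:R).
Proof.
rewrite -sumQ => meanm; under eq_bigl do rewrite -card_Z.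
exact (marks_upper_tail mass_ge0 ZQ indep u (fun r => p01 (r, j)) meanm).
Qed.

Lemma weight_lower_tail (m u : R) :
  m <= \sum_(r < t | (a <= r <= b)%N) prob_one R n r ->
  \sum_(f | (weight_in (codeword (grid_mx f) j) a b)%:R <= u) bernoulli_mass p f
    <= expR (u - m / 2%:R).
Proof.
rewrite -sumQ => meanm; under eq_bigl do rewrite -card_Z.
exact (marks_lower_tail mass_ge0 ZQ indep u (fun r => p01 (r, j)) meanm).
Qed.

End Column.

Section Collision.
Variables (j j' : 'I_n) (a b : nat) (q : 'I_t -> 'I_t).
Hypotheses (jj' : j != j') (q_inj : injective q).
Let Q : {set 'I_t} := finset (fun r : 'I_t => (a <= r <= b)%N).

Definition collisions (f : {ffun cell -> bool}) : {set 'I_t} :=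
  finset (fun r : 'I_t => (r \in Q) && (f (r, j) && f (q r, j'))).

Let ZQ f : collisions f \subset Q.
Proof. by apply/fintype.subsetP => r; rewrite !inE => /andP[]. Qed.

Let indep (B : {set 'I_t}) : B \subset Q ->
  \sum_(f | B \subset collisions f) bernoulli_mass p f =
  \prod_(r in B) (p (r, j) * p (q r, j')).
Proof.
move=> /fintype.subsetP BQ.
pose g (r : 'I_t) : cell := (r, j); pose h (r : 'I_t) : cell := (q r, j').
have g_inj : injective g by move=> r r' [].
have h_inj : injective h by move=> r r' [/q_inj].
(* The two families of cells lie in different columns; with [q] injective, all the cells involved
   are distinct, hence independent. *)
have gh : fintype.disjoint (mem (g @: B)) (mem (h @: B)).
  rewrite disjoint_subset; apply/fintype.subsetP => _ /imsetP[r _ ->].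
  by rewrite inE; apply/imsetP => -[r' _ [_ /eqP]]; rewrite (negbTE jj').
rewrite big_split /= -(big_imset p (h := g)) /=; last by move=> r r' _ _; apply: g_inj.
rewrite -(big_imset p (h := h)) /=; last by move=> r r' _ _; apply: h_inj.
have <- : \prod_(e in (g @: B :|: h @: B)%SET) p e =
    (\prod_(e in g @: B) p e) * \prod_(e in h @: B) p e.
  by rewrite -bigU //; apply: eq_bigl => e; rewrite finset.in_setU.
rewrite -bernoulli_mass_all_ones; apply: eq_bigl => f.
apply/fintype.subsetP/fintype.subsetP => H.
  by move=> e; rewrite finset.in_setU => /orP[] /imsetP[r /H + ->];
    rewrite !inE => /and3P[].
move=> r rB; have /= := H (g r); have /= := H (h r); have := BQ _ rB.
by rewrite !finset.in_setU !imset_f ?orbT // !inE => -> -> // ->.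
Qed.

Lemma collision_upper_tail (m u : R) :
  \sum_(r < t | (a <= r <= b)%N) prob_one R n r * prob_one R n (q r) <= m ->
  \sum_(f | u <= #|collisions f|%:R) bernoulli_mass p f <= expR (m - u / 2%:R).
Proof.
move=> meanm; apply: (marks_upper_tail mass_ge0 ZQ indep).
  move=> r; have /andP[x0 x1] := p01 (r, j); have /andP[y0 y1] := p01 (q r, j').
  by rewrite mulr_ge0 // mulr_ile1.
by apply: le_trans meanm; rewrite le_eqVlt; apply/orP; left; apply/eqP;
  apply: eq_bigl => r; rewrite inE.
Qed.

End Collision.

(** Neighbouring positions of a spread column share entries, so their marks are not independent.
    Each of the three shifts taken alone has independent marks. *)
Lemma weight_spread_le f (j j' : 'I_n) (i : int) a b :
  (weight_in (vand (codeword (grid_mx f) j) (spread (codeword (grid_mx f) j') i)) a b <=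
   #|collisions j j' a b (fun r => shift_pos r (i - 1)) f| +
   #|collisions j j' a b (fun r => shift_pos r i) f| +
   #|collisions j j' a b (fun r => shift_pos r (i + 1)) f|)%N.
Proof.
have cE q : #|collisions j j' a b q f| =
    (\sum_(r < t) (r \in collisions j j' a b q f))%N.
  by rewrite -sum1_card big_mkcond.
rewrite weight_inE !cE -!big_split; apply: leq_sum => r _.
rewrite !inE !ffunE !mxE /=.
by case: (a <= r)%N; case: (r <= b)%N; do 4 case: (f _).
Qed.

End MatrixTails.

(** * The union bound on a finite space *)

Section UnionBound.
Variables (R : realType) (O : finType) (mu : O -> R).
Hypothesis mu_ge0 : forall o, 0 <= mu o.

Lemma sum_pred_sub (P Q : pred O) : (forall o, P o -> Q o) ->
  \sum_(o | P o) mu o <= \sum_(o | Q o) mu o.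
Proof.
move=> PQ; rewrite big_mkcond [leRHS]big_mkcond; apply: ler_sum => o _.
by case: ifP => [/PQ -> //|_]; case: ifP.
Qed.

Lemma sum_predU_le (P Q : pred O) (x z : R) :
  \sum_(o | P o) mu o <= x -> \sum_(o | Q o) mu o <= z ->
  \sum_(o | P o || Q o) mu o <= x + z.
Proof.
move=> Px Qz; apply: le_trans (lerD Px Qz).
rewrite big_mkcond [in leRHS]big_mkcond [X in _ <= _ + X]big_mkcond -big_split.
apply: ler_sum => o _; case: (P o); case: (Q o) => /=.
- by rewrite lerDl mu_ge0.
- by rewrite addr0.
- by rewrite add0r.
- by rewrite addr0.
Qed.

Lemma sum_exists_le (I : finType) (E : I -> pred O) :
  \sum_(o | [exists i, E i o]) mu o <= \sum_i \sum_(o | E i o) mu o.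
Proof.
rewrite (exchange_big_dep xpredT) //= [leLHS]big_mkcond; apply: ler_sum => o _.
case: ifP => [/existsP[i Eio]|_]; last exact: sumr_ge0.
by rewrite (bigD1 i) //= lerDl sumr_ge0.
Qed.

End UnionBound.

(* [y] is the square root of the constant [c] of the algorithm and [a] is its
   parameter alpha/2; [s], [G] and [H] satisfy c k^2 / a^(2 + eps) = (s G)^2 and
   H = a G = a^(- eps/2). *)
Section Thresholds.
Variables (R : realType) (eps y a : R) (n k : nat).
Hypotheses (eps_gt0 : 0 < eps) (y_ge : 32%:R <= y) (a_gt0 : 0 < a) (a_le : a <= 2^-1).
Hypotheses (k_ge2 : (2 <= k)%N) (k_le : (k <= n)%N).

Let n_ge2 : (2 <= n)%N := leq_trans k_ge2 k_le.
Let L : R := ln n%:R.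
Let c : R := y ^+ 2.
Let Lam : R := - ln a.
Let G : R := expR ((1 + eps / 2%:R) * Lam).
Let H : R := expR (eps / 2%:R * Lam).
Let s : R := k%:R * y.
Let lo : nat := tau1 c n k.
Let hi : nat := tau2 eps c a n k.
Let t : nat := nrows eps c a n.

Let L_ge : 2^-1 <= L. Proof. exact: ln_nat_ge. Qed.

Let L_gt0 : 0 < L. Proof. by have := L_ge; lra. Qed.

Lemma powR_expR_log (x : R) : (a `^ x)^-1 = expR (x * Lam).
Proof. by rewrite /powR gt_eqF // -expRN mulrN. Qed.

Lemma logV_ge : 2^-1 <= Lam.
Proof.
apply: le_trans (ln2_ge R) _; rewrite /Lam -lnV ?posrE // ler_ln ?posrE ?invr_gt0 //.
by rewrite -[2]invrK lef_pV2 ?posrE ?invr_gt0.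
Qed.

Let aG : a * G = H.
Proof.
have -> : a = expR (- Lam) by rewrite /Lam opprK lnK.
by rewrite /G /H -expRD; congr expR; lra.
Qed.

Let H_ge1 : 1 <= H.
Proof.
have := expR_ge1Dx (eps / 2%:R * Lam); have := logV_ge; rewrite -/H => Lam_ge h.
by apply: (le_trans _ h); rewrite lerDl mulr_ge0 ?divr_ge0 // ltW // (lt_le_trans _ Lam_ge).
Qed.

Let G_ge : 2%:R * H <= G.
Proof.
rewrite -aG mulrA -[leRHS]mul1r ler_wpM2r ?expR_ge0 //; have := a_le; lra.
Qed.

Let GG : G * G = (a `^ (2%:R + eps))^-1.
Proof. by rewrite powR_expR_log /G -expRD; congr expR; lra. Qed.

Let s_ge : 2%:R * y <= s.
Proof. by rewrite ler_wpM2r ?ler_nat //; have := y_ge; lra. Qed.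

Let s_ge64 : 64%:R <= s. Proof. by have := s_ge; have := y_ge; lra. Qed.

Let s_ge0 : 0 <= s. Proof. by have := s_ge64; lra. Qed.

Let ssL_ge0 : 0 <= s * s * L. Proof. exact: mulr_ge0 (mulr_ge0 s_ge0 s_ge0) (ltW L_gt0). Qed.

Let GG_ge0 : 0 <= G * G. Proof. exact: mulr_ge0 (expR_ge0 _) (expR_ge0 _). Qed.

Let loE : lo = Num.truncn (s * s * L / 64%:R).
Proof. by congr Num.truncn; rewrite /c /s /L; field. Qed.

Let hiE : hi = Num.truncn (s * s * (G * G) * L).
Proof. by congr Num.truncn; rewrite GG /c /s /L; ring. Qed.

Let lo_le : lo%:R <= s * s * L / 64%:R.
Proof. by rewrite loE truncn_le (divr_ge0 ssL_ge0). Qed.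

(** Rounding down loses less than 1, and s^2 L / 128 is at least 16, so halving the real threshold
    covers the loss. *)
Let lo_ge : s * s * L / 128%:R <= lo%:R.
Proof.
have := truncnS_gt (s * s * L / 64%:R); rewrite -loE -[lo.+1%:R]natr1.
have ss : 64%:R * 64%:R <= s * s by rewrite ler_pM ?ler0n.
have : 64%:R * 64%:R * 2^-1 <= s * s * L by apply: ler_pM => //; lra.
lra.
Qed.

Let hi_le : hi%:R <= s * s * (G * G) * L.
Proof. rewrite hiE truncn_le; exact: mulr_ge0 (mulr_ge0 (mulr_ge0 s_ge0 s_ge0) GG_ge0) (ltW L_gt0). Qed.

Let hi_gt : s * s * (G * G) * L <= hi%:R + 1.
Proof. by rewrite natr1 hiE ltW ?truncnS_gt. Qed.

Lemma tau1_gt0 : (0 < lo)%N.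
Proof.
rewrite -(ltr0n R); apply: lt_le_trans lo_ge.
have s_gt0 : 0 < s by have := s_ge64; lra.
exact: divr_gt0 (mulr_gt0 (mulr_gt0 s_gt0 s_gt0) L_gt0) (ltr0Sn _ _).
Qed.

Lemma tau1_le_tau2 : (lo <= hi)%N.
Proof.
rewrite loE hiE le_truncn //.
have GG1 : 1 <= G * G by rewrite -[1]mulr1 ler_pM //; have := G_ge; have := H_ge1; lra.
have := ler_wpM2l ssL_ge0 GG1; have := ssL_ge0; lra.
Qed.

Lemma tau2_lt_nrows : (hi < t)%N.
Proof.
rewrite ltnS le_truncn //.
rewrite -[c / _ * _]mulrA [_^-1 * _]mulrC ler_wpM2r ?(ltW L_gt0) //.
rewrite ler_wpM2l ?sqr_ge0 // ler_wpM2r ?invr_ge0 ?powR_ge0 //.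
by rewrite lerXn2r ?nnegrE ?ler0n ?ler_nat.
Qed.

Let lo_lt : (lo < t)%N := leq_ltn_trans tau1_le_tau2 tau2_lt_nrows.

(** The main term is 2 sqrt(L) sqrt(s^2 L / 64) = L s / 4. *)
Lemma prefix_mean :
  \sum_(r < t | (0 <= r <= lo)%N) prob_one R n r <= 1 + L * s / 4%:R.
Proof.
rewrite sum_ord_itv //; apply: le_trans (sum_prob_one_upper R n_ge2 lo) _.
rewrite lerD2l -mulrA -/L.
have : Num.sqrt lo%:R <= s * Num.sqrt L / 8%:R.
  apply: (@le_trans _ _ (Num.sqrt ((s / 8%:R) ^+ 2 * L))).
    rewrite ler_sqrt; first by have := lo_le; lra.
    exact: mulr_ge0 (sqr_ge0 _) (ltW L_gt0).
  rewrite sqrtrM ?sqr_ge0 // sqrtr_sqr ger0_norm; have := s_ge64; lra.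
move=> /(ler_wpM2l (sqrtr_ge0 L)) h.
have LL : Num.sqrt L * Num.sqrt L = L by rewrite -expr2 sqr_sqrtr ?ltW.
have -> : L * s / 4%:R = 2%:R * (Num.sqrt L * (s * Num.sqrt L / 8%:R)).
  by rewrite -[in LHS]LL; lra.
by rewrite ler_pM2l.
Qed.

(** The square roots at the two ends are at least s G sqrt(L) and at most (s/8 + 1) sqrt(L). Since G
    >= 2 and s >= 64, the lower end removes at most an eighth of the upper one, whence 7/4 in place
    of 2. *)
Lemma window_mean :
  7%:R / 4%:R * (L * s * G) <= \sum_(r < t | (lo <= r <= hi)%N) prob_one R n r.
Proof.
rewrite sum_ord_itv ?tau2_lt_nrows //.
apply: le_trans (sum_prob_one_lower R n_ge2 (leqW tau1_le_tau2)); rewrite -/L.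
set u := Num.sqrt L.
have u_ge0 : 0 <= u := sqrtr_ge0 _.
have uu : u * u = L by rewrite -expr2 sqr_sqrtr ?ltW.
have upper : Num.sqrt (lo%:R + L) <= (s / 8%:R + 1) * u.
  apply: (@le_trans _ _ (Num.sqrt ((s / 8%:R + 1) ^+ 2 * L))).
    rewrite ler_sqrt; last by exact: mulr_ge0 (sqr_ge0 _) (ltW L_gt0).
    have sL := mulr_ge0 s_ge0 (ltW L_gt0).
    have := lo_le; lra.
  rewrite sqrtrM ?sqr_ge0 // sqrtr_sqr ger0_norm //; have := s_ge64; lra.
have lower : s * G * u <= Num.sqrt (hi.+1%:R + L).
  apply: (@le_trans _ _ (Num.sqrt ((s * G) ^+ 2 * L))); last first.
    rewrite ler_sqrt; last by rewrite addr_ge0 ?(ltW L_gt0).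
    by have := hi_gt; rewrite natr1; have := L_gt0; lra.
  rewrite sqrtrM ?sqr_ge0 // sqrtr_sqr ger0_norm //.
  exact: mulr_ge0 s_ge0 (expR_ge0 _).
have gap : 7%:R / 8%:R * (s * G) <= s * G - (s / 8%:R + 1).
  have : s * 2%:R <= s * G.
    apply: (ler_wpM2l s_ge0).
    by have := G_ge; have := H_ge1; lra.
  have := s_ge64; lra.
have : 7%:R / 8%:R * (s * G) * u <= Num.sqrt (hi.+1%:R + L) - Num.sqrt (lo%:R + L).
  by have := ler_wpM2r u_ge0 gap; lra.
move=> /(ler_wpM2l (mulr_ge0 (ler0n _ 2) u_ge0)).
by move=> h; apply: (le_trans _ h); rewrite -[in leLHS]uu; lra.
Qed.

Lemma collision_mean (q : 'I_t -> 'I_t) : injective q ->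
  \sum_(r < t | (lo <= r <= hi)%N) prob_one R n r * prob_one R n (q r) <=
  L * (20%:R + (4%:R + 2%:R * eps) * Lam).
Proof.
move=> q_inj; have lohi : (0 < lo <= hi)%N by rewrite tau1_gt0 tau1_le_tau2.
apply: le_trans (sum_collision R n_ge2 q_inj lohi tau2_lt_nrows) _; rewrite -/L.
have lo_gt0 : 0 < lo%:R :> R by rewrite ltr0n tau1_gt0.
have hi_gt0 : 0 < hi%:R :> R by rewrite ltr0n (leq_trans tau1_gt0 tau1_le_tau2).
have inv_lo : lo%:R^-1 <= 1 :> R by rewrite invf_le1 // ler1n tau1_gt0.
have ln_ratio : ln (hi%:R / lo%:R : R) <= 7%:R + (2%:R + eps) * Lam.
  (* The ratio hi/lo is at most 128 G^2, independently of k and n; its logarithm therefore costs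
     only a constant plus a multiple of [Lam]. *)
  apply: (@le_trans _ _ (ln (2 ^+ 7 * (G * G)))).
    rewrite ler_ln ?posrE ?divr_gt0 ?mulr_gt0 ?exprn_gt0 ?expR_gt0 //.
    rewrite ler_pdivrMr //; apply: le_trans hi_le _.
    by have := ler_wpM2l GG_ge0 lo_ge; rewrite -natrX; lra.
  rewrite lnM ?posrE ?mulr_gt0 ?exprn_gt0 ?expR_gt0 // lnXn // /G -expRD expRK.
  have ln2_le : ln (2 : R) <= 1.
    by have := @le_ln1Dx R 1; rewrite (_ : 1 + 1 = 2); [apply|]; lra.
  by move: ln2_le; lra.
have root : Num.sqrt (L / lo%:R) <= 2%:R * L.
  apply: (@le_trans _ _ 1); last by have := L_ge; lra.
  rewrite -[leRHS]sqrtr1 ler_sqrt // ler_pdivrMr // mul1r; apply: le_trans lo_ge.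
  rewrite -[leLHS]mul1r mulrAC ler_wpM2r ?(ltW L_gt0) //.
  have : 64%:R * 64%:R <= s * s by rewrite ler_pM ?ler0n.
  lra.
have := ler_wpM2l (ltW L_gt0) (lerD inv_lo ln_ratio).
lra.
Qed.

Let mass := bernoulli_mass (fun e : 'I_t * 'I_n => prob_one R n e.1).
Let mass_ge0 f : 0 <= mass f.
Proof. by apply: bernoulli_mass_ge0 => e; rewrite ltW ?prob_one_gt0 ?prob_one_le1. Qed.

Definition pair_ok (f : {ffun 'I_t * 'I_n -> bool}) (j j' : 'I_n) (i : 'I_t) : Prop :=
  weight_ineq a (codeword (grid_mx f) j) lo hi /\
  collision_ineq a (codeword (grid_mx f) j) (codeword (grid_mx f) j') k (i : nat)%:Z lo hi.

Let hits (f : {ffun 'I_t * 'I_n -> bool}) (j j' : 'I_n) (e : int) : nat :=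
  #|collisions j j' lo hi (fun r => shift_pos r e) f|.

(** As a G = H, the second threshold gives a W >= (3/4) L s H, which covers the prefix. The three
    shifts cost at most L y H / 2 together; multiplied by k - 1 this is below L s H / 2, and L s H
    >= 32 leaves room for the -1. *)
Lemma pair_ok_of_thresholds f j j' (i : 'I_t) :
  (weight_in (codeword (grid_mx f) j) 0 lo)%:R <= 3%:R / 4%:R * (L * s * H) ->
  3%:R / 4%:R * (L * s * G) <= (weight_in (codeword (grid_mx f) j) lo hi)%:R ->
  (hits f j j' ((i : nat)%:Z - 1))%:R <= L * y * H / 6%:R ->
  (hits f j j' (i : nat)%:Z)%:R <= L * y * H / 6%:R ->
  (hits f j j' ((i : nat)%:Z + 1))%:R <= L * y * H / 6%:R ->
  pair_ok f j j' i.
Proof.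
move=> V_le W_ge h1 h2 h3.
have aW : 3%:R / 4%:R * (L * s * H) <=
    a * (weight_in (codeword (grid_mx f) j) lo hi)%:R.
  by apply: le_trans (ler_wpM2l (ltW a_gt0) W_ge); rewrite -aG; lra.
split; first exact: le_trans aW.
rewrite /collision_ineq floor_ge_int.
have k1_gt0 : 0 < k.-1%:R :> R by rewrite ltr0n; case: (k) k_ge2 => [|[]].
rewrite ler_pdivlMr //.
have spread_le := weight_spread_le f j j' (i : nat)%:Z lo hi.
rewrite -(ler_nat R) !natrD in spread_le.
have col_le : (weight_in (vand (codeword (grid_mx f) j)
    (spread (codeword (grid_mx f) j') (i : nat)%:Z)) lo hi)%:R <= L * y * H / 2%:R.
  move: h1 h2 h3 spread_le; rewrite /hits; lra.
apply: le_trans (ler_wpM2r (ltW k1_gt0) col_le) _.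
have kE : k%:R = k.-1%:R + 1 :> R by rewrite natr1 prednK // ltnW.
have LyH_ge0 : 0 <= L * y * H.
  by rewrite (mulr_ge0 (mulr_ge0 (ltW L_gt0) _)) ?expR_ge0 //; have := y_ge; lra.
have LsHE : L * s * H = k.-1%:R * (L * y * H) + L * y * H by rewrite /s kE; ring.
have LsH_ge : 2^-1 * 64%:R * 1 <= L * s * H.
  have Ls_ge : 2^-1 * 64%:R <= L * s by apply: (ler_pM _ _ L_ge s_ge64); lra.
  by apply: (ler_pM _ _ Ls_ge H_ge1); lra.
move: aW LsHE LsH_ge; lra.
Qed.

Let U : R := L * (20%:R + (4%:R + 2%:R * eps) * Lam) - L * y * H / 12%:R.

(** Five bad events, one for each threshold. [U] is the exponent of a collision tail, its mean bound
    minus half of L y H / 6. The weight tails decay with L s H, which is at least L y H, so [U]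
    bounds their exponents too. *)
Lemma pair_fail_mass j j' (i : 'I_t) : j != j' ->
  \sum_(f | ~~ `[< pair_ok f j j' i >]) mass f <= 5%:R * expR U.
Proof.
move=> jj'.
have LH_ge : L * y * H <= L * s * H.
  rewrite ler_wpM2r ?expR_ge0 // ler_wpM2l ?(ltW L_gt0) //.
  by have := s_ge; have := y_ge; lra.
have U_ge : 2%:R * L * 10%:R - L * s * H / 12%:R <= U.
  have : 0 <= L * ((4%:R + 2%:R * eps) * Lam).
    apply: (mulr_ge0 (ltW L_gt0)); apply: mulr_ge0; first by have := eps_gt0; lra.
    by have := logV_ge; lra.
  rewrite /U; lra.
have tailV : \sum_(f | 3%:R / 4%:R * (L * s * H) <=
      (weight_in (codeword (grid_mx f) j) 0 lo)%:R) mass f <= expR U.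
  apply: le_trans (weight_upper_tail j _ prefix_mean) _; rewrite ler_expR.
  apply: le_trans U_ge.
  have : L * s * 1 <= L * s * H by apply: (ler_wpM2l (mulr_ge0 (ltW L_gt0) s_ge0)).
  have : 0 <= L * s * 1 by rewrite mulr1; apply: (mulr_ge0 (ltW L_gt0) s_ge0).
  by have := L_ge; lra.
have tailW : \sum_(f | (weight_in (codeword (grid_mx f) j) lo hi)%:R <=
      3%:R / 4%:R * (L * s * G)) mass f <= expR U.
  apply: le_trans (weight_lower_tail j _ window_mean) _; rewrite ler_expR.
  apply: le_trans U_ge.
  have : L * s * (2%:R * H) <= L * s * G by apply: (ler_wpM2l (mulr_ge0 (ltW L_gt0) s_ge0)).
  have : 0 <= L * s * H by apply: mulr_ge0 (expR_ge0 _); apply: (mulr_ge0 (ltW L_gt0) s_ge0).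
  by have := L_ge; lra.
have tailS (e : int) :
    \sum_(f | L * y * H / 6%:R <= (hits f j j' e)%:R) mass f <= expR U.
  apply: le_trans (collision_upper_tail jj' (@shift_pos_inj t e) _
    (collision_mean (@shift_pos_inj t e))) _.
  by rewrite ler_expR /U; lra.
have -> : 5%:R * expR U = expR U + (expR U + (expR U + (expR U + expR U))) by lra.
apply: le_trans (sum_predU_le mass_ge0 tailV (sum_predU_le mass_ge0 tailW
  (sum_predU_le mass_ge0 (tailS ((i : nat)%:Z - 1)) (sum_predU_le mass_ge0
  (tailS (i : nat)%:Z) (tailS ((i : nat)%:Z + 1)))))).
apply: (sum_pred_sub mass_ge0) => f; apply: contraNT; rewrite !negb_or -!ltNge.
move=> /and5P[V W h1 h2 h3]; apply/asboolP.
by apply: pair_ok_of_thresholds; apply: ltW.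
Qed.

End Thresholds.

(** * Failure probability of one random matrix *)

Section FailureProbability.
Variables (R : realType) (eps b y a : R) (n : nat).
Hypotheses (eps_gt0 : 0 < eps) (a_gt0 : 0 < a) (a_le : a <= 2^-1).
Hypotheses (n_ge2 : (2 <= n)%N) (y_ge1 : 192%:R ^+ 2 <= y).
Hypotheses (y_ge2 : 24%:R * (31%:R + b) <= y).
Hypotheses (y_ge3 : 24%:R * (8%:R + 4%:R * eps) <= y * eps).
Let c : R := y ^+ 2.
Let t : nat := nrows eps c a n.
Let L : R := ln n%:R.
Let Lam : R := - ln a.
Let mass := bernoulli_mass (fun e : 'I_t * 'I_n => prob_one R n e.1).
Let U : R := L * (20%:R + (4%:R + 2%:R * eps) * Lam) -
  L * y * expR (eps / 2%:R * Lam) / 12%:R.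

Let y_ge : 32%:R <= y. Proof. by apply: le_trans y_ge1; lra. Qed.

Let L_ge : 2^-1 <= L := ln_nat_ge R n_ge2.

Let nE : n%:R = expR L. Proof. by rewrite lnK // posrE ltr0n ltnW. Qed.

Let nE2 : 2 <= expR L. Proof. by rewrite -nE ler_nat. Qed.

(** One factor n absorbs ln n, and the factor 2 absorbs the extra row. *)
Lemma nrows_le : t%:R <= 2%:R * (c * expR ((2%:R + eps) * Lam)) * n%:R ^+ 3.
Proof.
set E := expR _.
have c_ge1 : 1 <= c by rewrite /c expr2 -[1]mulr1; apply: ler_pM => //; have := y_ge; lra.
have Lam_ge := logV_ge a_gt0 a_le.
have E_ge1 : 1 <= E.
  rewrite -[1]expR0 ler_expR; apply: mulr_ge0; first by have := eps_gt0; lra.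
  by move: Lam_ge; rewrite -/Lam; lra.
have cE_ge1 : 1 <= c * E by rewrite -[1]mulr1; apply: ler_pM => //; lra.
have n_ge1 : 1 <= n%:R :> R by rewrite ler1n ltnW.
have L_le : L <= n%:R by apply: ltW; apply: ln_sublinear; rewrite ltr0n ltnW.
have nn : 0 <= n%:R ^+ 2 :> R by rewrite exprn_ge0.
rewrite /t /nrows -natr1 (powR_expR_log a_gt0) -/Lam -/E -/L.
have x_le : c * E * n%:R ^+ 2 * L <= c * E * n%:R ^+ 3.
  rewrite [n%:R ^+ 3]exprSr -mulrA; apply: ler_wpM2l; first by lra.
  exact: ler_wpM2l.
have x_ge0 : 0 <= c * E * n%:R ^+ 2 * L.
  apply: mulr_ge0; last by have := L_ge; lra.
  by apply: mulr_ge0 => //; lra.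
have n3_ge1 : 1 <= n%:R ^+ 3 :> R by apply: exprn_ege1.
have := ler_pM ler01 ler01 cE_ge1 n3_ge1; rewrite mulr1.
have : (Num.truncn (c * E * n%:R ^+ 2 * L))%:R <= c * E * n%:R ^+ 2 * L.
  by rewrite truncn_le.
lra.
Qed.

(** By exp(u) >= 1 + u, the gain L y H / 12 is at least L y / 12 + L y eps Lam / 24. Half of the
    first term pays for ln c ([y_ge1]), the other half for (11 + 20 + b) L ([y_ge2]). The second
    term pays for all multiples of [Lam] ([y_ge3]), where 1 <= 2 L puts the factor L in front of
    those coming from the row count. *)
Lemma total_exponent :
  (n.+1 * n * n * t)%:R * (5%:R * expR U) <= n%:R `^ (- b).
Proof.
set E := expR ((2%:R + eps) * Lam).
have Lam_ge := logV_ge a_gt0 a_le; rewrite -/Lam in Lam_ge.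
have y_gt0 : 0 < y by have := y_ge; lra.
have cE : c = expR (ln c) by rewrite lnK // posrE exprn_gt0.
(* ln c = 4 ln (sqrt y) <= 4 sqrt y <= y / 48 <= L y / 24 *)
have ln_c : ln c <= L * y / 24%:R.
  set w := Num.sqrt y.
  have w_gt0 : 0 < w by rewrite sqrtr_gt0.
  have ww : w * w = y by rewrite -expr2 sqr_sqrtr // ltW.
  have w_ge : 192%:R <= w.
    have -> : 192%:R = Num.sqrt (192%:R ^+ 2) :> R by rewrite sqrtr_sqr ger0_norm.
    by rewrite ler_sqrt // ltW.
  have -> : c = w ^+ 4 by rewrite /c -ww; ring.
  have := ln_sublinear w_gt0; rewrite lnXn // => ln_w.
  have : w * 192%:R <= y by rewrite -ww ler_wpM2l // ltW.
  have : 2^-1 * y <= L * y by rewrite ler_wpM2r // ltW.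
  rewrite -[_ *+ 4]mulr_natl; lra.
have n1 : n.+1%:R <= expR L ^+ 2.
  rewrite -natr1 nE expr2; have := nE2; have := ler_wpM2l (expR_ge0 L) nE2; lra.
have t_le := nrows_le; rewrite -/E nE in t_le.
have ten : 10%:R <= expR L ^+ 4.
  apply: (@le_trans _ _ (2 ^+ 4)); first by rewrite -natrX ler_nat.
  by rewrite lerXn2r ?nnegrE ?expR_ge0.
have E_ge0 : 0 <= c * E by rewrite mulr_ge0 ?expR_ge0 ?sqr_ge0.
(* Powers of n: 2 for n + 1, 1 for each column index, 3 for the rows, and 4 for the constant 10 = 5
   * 2, the 2 coming from [nrows_le]. *)
have count_le : (n.+1 * n * n * t)%:R * 5%:R <=
    expR (ln c + (2%:R + eps) * Lam + 11%:R * L).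
  have -> : expR (ln c + (2%:R + eps) * Lam + 11%:R * L) = c * E * expR L ^+ 11.
    by rewrite !expRD -cE expRM_natl.
  rewrite !natrM nE.
  have -> : c * E * expR L ^+ 11 =
    expR L ^+ 2 * expR L * expR L * ((c * E) * expR L ^+ 3) * expR L ^+ 4 by ring.
  have -> : n.+1%:R * expR L * expR L * t%:R * 5%:R =
    n.+1%:R * expR L * expR L * (t%:R / 2%:R) * 10%:R by lra.
  have e0 := expR_ge0 L.
  have nee_ge0 : 0 <= n.+1%:R * expR L * expR L by rewrite !mulr_ge0.
  have t_ge0 : 0 <= t%:R / 2 :> R by rewrite divr_ge0.
  have t_half : t%:R / 2 <= c * E * expR L ^+ 3 by move: t_le; lra.
  have nee_le : n.+1%:R * expR L * expR L <= expR L ^+ 2 * expR L * expR L.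
    by do 2 apply: (ler_wpM2r e0).
  exact: ler_pM (mulr_ge0 nee_ge0 t_ge0) (ler0n _ _) (ler_pM nee_ge0 t_ge0 nee_le t_half) ten.
rewrite mulrA; apply: le_trans (ler_wpM2r (expR_ge0 U) count_le) _.
rewrite -expRD nE -expRM ler_expR.
have hH := expR_ge1Dx (eps / 2%:R * Lam).
have Ly_ge0 : 0 <= L * y by rewrite mulr_ge0 ?(ltW y_gt0) //; have := L_ge; lra.
have hLyH := ler_wpM2l Ly_ge0 hH.
have eLam_ge0 : 0 <= (2%:R + eps) * Lam.
  by apply: mulr_ge0; [have := eps_gt0; lra | lra].
have LeLam : 2^-1 * ((2%:R + eps) * Lam) <= L * ((2%:R + eps) * Lam).
  by rewrite ler_wpM2r.
have L_ge0 : 0 <= L by have := L_ge; lra.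
have h2 := ler_wpM2l L_ge0 y_ge2.
have Lam_ge0 : 0 <= Lam by lra.
have h3 := ler_wpM2l (mulr_ge0 L_ge0 Lam_ge0) y_ge3.
rewrite /U; lra.
Qed.

Lemma collision_bound_fail_mass :
  \sum_(f | ~~ `[< collision_bound a (tau1 c) (tau2 eps c a) (grid_mx f) >]) mass f
    <= n%:R `^ (- b).
Proof.
have mass_ge0 f : 0 <= mass f.
  by apply: bernoulli_mass_ge0 => e; rewrite ltW ?prob_one_gt0 ?prob_one_le1.
apply: le_trans total_exponent.
(* The product type also contains k <= 1 and j = j'; [E] is empty there, so these indices contribute
   nothing. *)
pose I := ('I_n.+1 * 'I_n * 'I_n * 'I_t)%type.
pose E (x : I) f := [&& (1 < x.1.1.1)%N, x.1.1.2 != x.1.2 &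
  ~~ `[< @pair_ok R eps y a n x.1.1.1 f x.1.1.2 x.1.2 x.2 >]].
have -> : (n.+1 * n * n * t)%:R * (5%:R * expR U) = \sum_(x : I) 5%:R * expR U.
  by rewrite sumr_const !card_prod !card_ord mulr_natl.
apply: (@le_trans _ _ (\sum_(x : I) \sum_(f | E x f) mass f)); last first.
  apply: ler_sum => -[[[k j] j'] i] _; rewrite /E /=.
  have [k_gt1|k_le1] := ltnP 1 k; last first.
    by rewrite big_pred0 // mulr_ge0 ?expR_ge0.
  have [jj'|jj'] := eqVneq j j'; first by rewrite big_pred0 // mulr_ge0 ?expR_ge0.
  exact: (pair_fail_mass eps_gt0 y_ge a_gt0 a_le k_gt1 (ltn_ord k) i jj').
apply: le_trans (sum_exists_le mass_ge0 E).
apply: (sum_pred_sub mass_ge0) => f; apply: contraNT => noE.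
apply/asboolP => k /andP[k_gt1 kn] j j' jj' i; apply: contrapT => bad.
move/negP: noE; apply; apply/existsP.
exists (Ordinal (kn : (k < n.+1)%N), j, j', i); rewrite /E /= k_gt1 jj' /=.
by apply/asboolPn.
Qed.

End FailureProbability.

(** * Independent copies of the random matrix *)

Section Independence.
Variables (d : measure_display) (Omega : measurableType d) (R : realType).
Variable P : probability Omega R.

(** Independence is given for the events alone. Complements enter one at a time, by induction on
    [s2], through P(A \ E) = P(A) - P(A and E). *)
Lemma mutually_independent_pattern (I : eqType) (E : I -> set Omega) (p : I -> R)
    (s1 s2 : seq I) :
  (forall i, measurable (E i)) -> (forall i, P (E i) = (p i)%:E) ->
  mutually_independent P E -> uniq (s1 ++ s2) ->
  P [set w | (forall i, i \in s1 -> E i w) /\ (forall i, i \in s2 -> ~ E i w)] =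
  (\prod_(i <- s1) p i * \prod_(i <- s2) (1 - p i))%:E.
Proof.
move=> mE pE indE; pose A (s1 s2 : seq I) := [set w | (forall i, i \in s1 -> E i w) /\
  (forall i, i \in s2 -> ~ E i w)].
have mA u v : measurable (A u v).
  have -> : A u v = (\bigcap_(i in [set` u]) E i) `&` (\bigcap_(i in [set` v]) ~` E i).
    by apply/seteqP; split=> w [h1 h2]; split=> i iu; [exact: h1|exact: h2|exact: h1|exact: h2].
  apply: measurableI; apply: fin_bigcap_measurable; try exact: finite_seq.
    by move=> i _; exact: mE.
  by move=> i _; apply: measurableC; exact: mE.
rewrite -/(A s1 s2); elim: s2 s1 => [|i s2 IH] s1.
  rewrite cats0 big_nil mulr1 => us1.
  have -> : A s1 [::] = \bigcap_(i in [set i | i \in s1]) E i.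
    by apply/seteqP; split=> w; [case=> h _ i; exact: h | move=> h; split=> // i /h].
  by rewrite indE // -prodEFin; apply: eq_bigr => i _; rewrite pE.
move=> us; have us' : uniq ((i :: s1) ++ s2).
  by rewrite -[uniq _](uniq_catCA s1 [:: i] s2).
have /andP[_ us''] : (i \notin s1 ++ s2) && uniq (s1 ++ s2) by [].
have AE : A s1 (i :: s2) = A s1 s2 `\` E i.
  apply/seteqP; split=> w.
    case=> h1 h2; split; last by apply: h2; rewrite mem_head.
    by split=> // j js; apply: h2; rewrite in_cons js orbT.
  case=> -[h1 h2] Ei; split=> // j; rewrite in_cons => /orP[/eqP -> //|]; exact: h2.
have AI : A s1 s2 `&` E i = A (i :: s1) s2.
  apply/seteqP; split=> w.
    by case=> -[h1 h2] Ei; split=> // j; rewrite in_cons => /orP[/eqP -> //|]; exact: h1.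
  case=> h1 h2; split; last by apply: h1; rewrite mem_head.
  by split=> // j js; apply: h1; rewrite in_cons js orbT.
have : P (A s1 s2) = (P (A s1 (i :: s2)) + P (A (i :: s1) s2))%E.
  by rewrite -AI AE; exact: measureDI.
have fin : P (A s1 (i :: s2)) \is a fin_num by exact: fin_num_measure.
rewrite !IH // -(fineK fin) -EFinD => -[] h; congr EFin.
by rewrite !big_cons in h *; lra.
Qed.

Lemma mutually_independent_ffun (I : finType) (E : I -> set Omega) (p : I -> R)
    (f : {ffun I -> bool}) :
  (forall i, measurable (E i)) -> (forall i, P (E i) = (p i)%:E) ->
  mutually_independent P E ->
  P [set w | forall i, E i w <-> f i] = (bernoulli_mass p f)%:E.
Proof.
move=> mE pE indE.
have -> : [set w | forall i, E i w <-> f i] =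
    [set w | (forall i, i \in enum [pred i | f i] -> E i w) /\
             (forall i, i \in enum [pred i | ~~ f i] -> ~ E i w)].
  apply/seteqP; split=> w.
    move=> h; split=> i; rewrite mem_enum inE; first by move=> fi; apply/h.
    by move=> /negP nf /h.
  case=> h1 h2 i; split; last by move=> fi; apply: h1; rewrite mem_enum.
  by move=> Ei; apply: contrapT => /negP nf; apply: (h2 i); rewrite ?mem_enum.
rewrite (mutually_independent_pattern mE pE) //.
  rewrite !big_enum /bernoulli_mass [in RHS](bigID (fun i => f i)) /=.
  by congr (_ * _)%:E; apply: eq_bigr => i; rewrite inE; [move=> ->|move=> /negbTE ->].
rewrite cat_uniq !enum_uniq andbT /=; apply/hasPn => i.
by rewrite !mem_enum !inE.
Qed.

End Independence.

Section RandomMatrices.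
Variables (d : measure_display) (Omega : measurableType d) (R : realType).
Variables (P : probability Omega R) (t n : nat).
Variable X : nat -> Omega -> 'M[bool]_(t, n).
Hypothesis randX : random_matrices P X.
Notation cell := ('I_t * 'I_n)%type.
Variable S : pred {ffun cell -> bool}.
Let mass := bernoulli_mass (fun e : cell => prob_one R n e.1).

Definition mx_grid (M : 'M[bool]_(t, n)) : {ffun cell -> bool} :=
  [ffun e => M e.1 e.2].

Lemma mx_gridK : cancel mx_grid (@grid_mx t n).
Proof. by move=> M; apply/matrixP => r j; rewrite mxE ffunE. Qed.

(** The first [N] copies form a single Bernoulli field indexed by ['I_N * cell], so independence
    between copies and within a copy is used at once. *)
Lemma all_copies_ffun N (G : {ffun 'I_N -> {ffun cell -> bool}}) :
  measurable [set w | forall m : 'I_N, mx_grid (X m w) = G m] /\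
  P [set w | forall m : 'I_N, mx_grid (X m w) = G m] = (\prod_m mass (G m))%:E.
Proof.
case: randX => m1 p1 ind1.
pose E (x : 'I_N * cell) := [set w | X x.1 w x.2.1 x.2.2].
have mE x : measurable (E x) by exact: (m1 (x.1 : nat, x.2)).
have pE x : P (E x) = (prob_one R n x.2.1)%:E by exact: (p1 (x.1 : nat, x.2)).
pose f := [ffun x : 'I_N * cell => G x.1 x.2].
have setE : [set w | forall m : 'I_N, mx_grid (X m w) = G m] =
    [set w | forall x, E x w <-> f x].
  apply/seteqP; split=> w h.
    by move=> x; rewrite /f ffunE -(h x.1) ffunE.
  move=> m; apply/ffunP => e; have := h (m, e); rewrite /E /f !ffunE /= => -[h1 h2].
  by apply/idP/idP.
split.
  rewrite setE (_ : [set w | _] = \bigcap_(x in [set: 'I_N * cell])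
      (if f x then E x else ~` E x)); last first.
    apply/seteqP; split=> w h x.
      move=> _; case: ifP => fx; first exact/h.
      by move=> /h; rewrite fx.
    have := h x I; case: ifP => fx Ex; split=> //.
  by apply: fin_bigcap_measurable => // x _; case: ifP => _ //; apply: measurableC.
rewrite setE (mutually_independent_ffun f mE pE).
  rewrite /bernoulli_mass; congr EFin; rewrite pair_big /=; apply: eq_bigr => x _.
  by rewrite ffunE.
move=> s us; pose g (x : 'I_N * cell) : nat * cell := (x.1 : nat, x.2).
have g_inj : injective g by move=> [m e] [m' e'] [/val_inj -> ->].
have := ind1 (map g s); rewrite map_inj_uniq // big_map => <- //; congr (P _).
apply/seteqP; split=> w h x /=.
  by move=> /mapP[y ys ->]; exact: h.
by move=> xs; apply: (h (g x)); rewrite /= map_f.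
Qed.

Let allS N := [set w | forall m, (m < N)%N -> S (mx_grid (X m w))].

(** Splitting into finitely many disjoint atoms gives both the measurability and the probability of
    the event. *)
Let allSE N : allS N =
  \bigcup_(G in [set` enum (ffun_on S : {pred {ffun 'I_N -> {ffun cell -> bool}}})])
    [set w | forall m : 'I_N, mx_grid (X m w) = G m].
Proof.
apply/seteqP; split=> w.
  move=> h; exists [ffun m : 'I_N => mx_grid (X m w)]; last by move=> m; rewrite ffunE.
  by rewrite /= mem_enum; apply/ffun_onP => m; rewrite ffunE; apply: h.
case=> G; rewrite /= mem_enum => /ffun_onP GS h m mN.
by have := GS (Ordinal mN); rewrite -h.
Qed.

Lemma all_copies_measurable N : measurable (allS N).
Proof.
rewrite allSE; apply: fin_bigcup_measurable; first exact: finite_seq.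
by move=> G _; have [] := all_copies_ffun G.
Qed.

Lemma all_copies_prob N : P (allS N) = ((\sum_(f | S f) mass f) ^+ N)%:E.
Proof.
rewrite allSE measure_fin_bigcup; last 3 first.
- exact: finite_seq.
- move=> G G' _ _ [w [/= h h']]; apply/ffunP => m; by rewrite -h.
- by move=> G _; have [] := all_copies_ffun G.
rewrite -fsbig_seq ?enum_uniq // big_enum /=.
under eq_bigr do rewrite (proj2 (all_copies_ffun _)).
rewrite sumEFin; congr EFin.
have -> : (\sum_(f | S f) mass f) ^+ N = \prod_(m < N) \sum_(f | S f) mass f.
  by rewrite prodr_const card_ord.
by rewrite (bigA_distr_big S (fun _ => mass)).
Qed.

End RandomMatrices.

(** * Running time of the loop *)

Section RunningTime.
Variables (R : realType) (t n : nat) (alpha : R) (t1 t2 : nat -> nat -> nat).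
Implicit Type X : nat -> 'M[bool]_(t, n).
Notation attempt := (@Defs.attempt R t n alpha t1 t2).

(** The loops never stop early, so the cost does not depend on the matrix. A pair check takes 19 t +
    8 steps: two weight counts of 4 t + 1, a collision count of 11 t + 1, and 5 single steps. *)
Definition attempt_cost : nat :=
  (t * n + (n.-1 * (n * (n * (t * (19 * t + 9) + 2) + 2) + 2) + 1))%N.

Lemma all_steps_cost I (s : seq I) (f : I -> timed bool) v :
  (forall x, (f x).2 = v) -> (all_steps s f).2 = (size s * v.+1 + 1)%N.
Proof. by move=> fv; elim: s => //= x s ->; rewrite fv; lia. Qed.

Lemma count_rows_cost a b (f : 'I_t -> timed bool) v :
  (forall x, (f x).2 = v) -> (count_rows a b f).2 = (t * (v + 3) + 1)%N.
Proof.
move=> fv; rewrite -{2}(size_enum_ord t) /count_rows.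
by elim: (enum 'I_t) => //= x s ->; rewrite fv; lia.
Qed.

Lemma attempt_costE M : (attempt M).2 = attempt_cost.
Proof.
rewrite /= /attempt_cost; congr addn.
rewrite (@all_steps_cost _ _ _ (n * (n * (t * (19 * t + 9) + 2) + 2) + 1)%N) => [|k].
  by rewrite size_iota; lia.
rewrite (@all_steps_cost _ _ _ (n * (t * (19 * t + 9) + 2) + 1)%N) => [|j].
  by rewrite size_enum_ord; lia.
rewrite (@all_steps_cost _ _ _ (t * (19 * t + 9) + 1)%N) => [|j'].
  by rewrite size_enum_ord; lia.
rewrite (@all_steps_cost _ _ _ (19 * t + 8)%N) => [|i].
  by rewrite size_enum_ord; lia.
rewrite /check_pair /bind /step; cbn [fst snd].
have readC a b : (count_rows a b (read M j)).2 = (t * 4 + 1)%N.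
  exact: (@count_rows_cost a b _ 1%N).
have collC a b e : (count_rows a b (read_collision M j j' e)).2 = (t * 11 + 1)%N.
  exact: (@count_rows_cost a b _ 8%N).
by rewrite !readC collC; lia.
Qed.

Lemma attempt_cost_le : (0 < t)%N -> (0 < n)%N ->
  (attempt_cost <= 40 * n ^ 3 * t ^ 2)%N.
Proof.
move=> t_gt0 n_gt0; rewrite /attempt_cost; set u := (t ^ 2)%N.
have t_le : (t <= u)%N by rewrite leq_pmulr.
have u_gt0 : (0 < u)%N by apply: leq_trans t_le.
(* Each enclosing loop of length n raises the constant by 2, since its overhead 2 is at most 2 n
   v. *)
have nest k x v : (0 < v -> x <= k * v -> n * x + 2 <= k.+2 * (n * v))%N.
  move=> v_gt0 xv; have nv_gt0 : (0 < n * v)%N by rewrite muln_gt0 n_gt0.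
  have := leq_mul (leqnn n) xv; rewrite mulnCA => h.
  by rewrite -[k.+2]addn2 mulnDl leq_add // -[leqLHS]muln1 leq_mul.
have h0 : (t * (19 * t + 9) + 2 <= 30 * u)%N.
  by rewrite mulnDr mulnCA -[(t * t)%N]/u; lia.
have nu_gt0 : (0 < n * u)%N by rewrite muln_gt0 n_gt0.
have h1 := nest _ _ _ u_gt0 h0.
have h2 := nest _ _ _ nu_gt0 h1.
have nnu_gt0 : (0 < n * (n * u))%N by rewrite muln_gt0 n_gt0.
have h3 := nest _ _ _ nnu_gt0 h2.
rewrite -[(40 * n ^ 3 * u)%N]mulnA (_ : n ^ 3 * u = n * (n * (n * u)))%N; last first.
  by rewrite !expnS expn0 muln1 !mulnA.
have h4 := leq_mul (leq_pred n) (leqnn (n * (n * (t * (19 * t + 9) + 2) + 2) + 2)).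
have h5 : (t * n <= n * (n * (n * u)))%N.
  rewrite mulnC leq_mul //; apply: leq_trans t_le _.
  by rewrite mulnA leq_pmull // muln_gt0 n_gt0.
lia.
Qed.

#[local] Opaque Defs.attempt attempt_cost.

Definition first_success X (l : nat) : Prop :=
  (attempt (X l)).1 /\ forall i, (i < l)%N -> ~~ (attempt (X i)).1.

(** As the cost is constant, a run is determined by the index of the first success; the shift by [m]
    makes the induction go through. *)
Lemma runsE X m M T : runs alpha t1 t2 X m M T <->
  exists l, [/\ first_success (fun i => X (m + i)%N) l, M = X (m + l)%N &
    T = (l.+1 * attempt_cost)%N].
Proof.
split.
  elim=> {m M T} [m ok|m M T ko _ [l [[okl kol] -> ->]]].
    exists 0%N; rewrite /first_success addn0 attempt_costE mul1n.
    by split; [split; [exact: ok|case]|reflexivity|reflexivity].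
  exists l.+1; rewrite /first_success addnS -addSn attempt_costE mulSn.
  split; [split; [exact: okl|]|reflexivity|reflexivity].
  case=> [|i] il; first by rewrite addn0; exact: ko.
  by rewrite addnS -addSn; exact: (kol i il).
case=> l; elim: l m M T => [|l IH] m M T [[okl kol] -> ->].
  rewrite mul1n -(attempt_costE (X m)) addn0; apply: runs_stop.
  by rewrite addn0 in okl; exact: okl.
rewrite mulSn -[X in runs _ _ _ _ _ _ (X + _)%N](attempt_costE (X m)).
apply: runs_retry; first by have := kol 0%N isT; rewrite addn0; apply.
rewrite addnS -addSn; apply: IH; split; [split|reflexivity|reflexivity].
  by move: okl; rewrite addnS -addSn; apply.
by move=> i il; rewrite addSn -addnS; exact: (kol i.+1 il).
Qed.

Lemma outputsE X M T : outputs alpha t1 t2 X M T <->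
  exists l, [/\ first_success X l, M = X l & T = (l.+1 * attempt_cost)%N].
Proof. exact: runsE. Qed.

Lemma first_success_inj X l l' :
  first_success X l -> first_success X l' -> l = l'.
Proof.
move=> [ok ko] [ok' ko']; case: (ltngtP l l') => // ll.
  by have := ko' _ ll; rewrite ok.
by have := ko _ ll; rewrite ok'.
Qed.

Lemma first_success_ex X : (exists l, (attempt (X l)).1) ->
  exists l, first_success X l.
Proof.
move=> /ex_minnP[l ok lmin]; exists l; split=> // i il.
by apply/negP => /lmin; rewrite leqNgt il.
Qed.

Definition all_fail X (N : nat) : bool := [forall i : 'I_N, ~~ (attempt (X i)).1].

Lemma all_failP X N :
  reflect (forall i, (i < N)%N -> ~~ (attempt (X i)).1) (all_fail X N).
Proof.
apply: (iffP forallP) => [h i iN|h i]; first exact: (h (Ordinal iN)).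
exact: h.
Qed.

(* The [N]-th attempt is run, at a fixed cost, exactly when all the previous
   ones fail. *)
Lemma runtimeE X : (0 < attempt_cost)%N -> runtime alpha t1 t2 X =
  (\sum_(N <oo) ((attempt_cost%:R : R) * (all_fail X N)%:R)%:E)%E.
Proof.
move=> C_gt0.
have term_ge0 N : (0 <= ((attempt_cost%:R : R) * (all_fail X N)%:R)%:E)%E.
  by rewrite lee_fin mulr_ge0.
have [[l lP]|none] := pselect (exists l, first_success X l).
  have failE N : all_fail X N = (N <= l)%N.
    apply/all_failP/idP => [h|Nl i iN].
      by rewrite leqNgt; apply/negP => /h; rewrite lP.1.
    by apply: lP.2; apply: leq_trans iN Nl.
  rewrite (nneseries_split 0 l.+1) // [X in (_ + X)%E]eseries0 ?adde0; last first.
    by move=> N; rewrite add0n => lN _; rewrite failE leqNgt lN mulr0.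
  rewrite add0n big_nat_cond (eq_bigr (fun=> (attempt_cost%:R)%:E)); last first.
    by move=> N; rewrite andbT ltnS => /andP[_ Nl]; rewrite failE Nl mulr1.
  rewrite -big_nat_cond sumEFin big_const_nat subn0 iter_addr_0.
  rewrite -[attempt_cost%:R *+ _]mulr_natl -natrM.
  rewrite /runtime (_ : [set T | _] = [set (l.+1 * attempt_cost)%N]).
    by rewrite image_set1 ereal_inf1.
  apply/seteqP; split=> T /=.
    by case=> M /outputsE[l' [l'P _ ->]]; rewrite (first_success_inj lP l'P).
  by move=> ->; exists (X l); apply/outputsE; exists l.
have failE N : all_fail X N.
  apply/all_failP => i _; apply/negP => ok; apply: none.
  by apply: first_success_ex; exists i.
(* Without a success the infimum is over the empty set, hence +oo; every term of the series then
   equals the cost, which is at least 1, so the partial sums exceed any [A]. *)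
rewrite /runtime (_ : [set T | _] = set0).
  rewrite image_set0 ereal_inf0; apply/esym/eqyP => A A_gt0.
  apply: le_trans (nneseries_lim_ge (Num.truncn A).+1 (fun N _ _ => term_ge0 N)).
  under eq_bigr do rewrite failE mulr1.
  rewrite sumEFin big_const_nat subn0 iter_addr_0 lee_fin.
  apply: (@le_trans _ _ (Num.truncn A).+1%:R); first exact/ltW/truncnS_gt.
  by rewrite -[leLHS]/(1 *+ _) lerMn2r ler1n C_gt0 orbT.
apply/seteqP; split=> T //= -[M /outputsE[l [lP _ _]]].
by apply: none; exists l.
Qed.

End RunningTime.

(** * Success probability and expected time of the loop *)

Section Algorithm.
Variables (R : realType) (t n : nat) (alpha : R) (t1 t2 : nat -> nat -> nat).
Variables (d : measure_display) (Omega : measurableType d) (P : probability Omega R).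
Variable X : nat -> Omega -> 'M[bool]_(t, n).
Hypothesis randX : random_matrices P X.
Notation cell := ('I_t * 'I_n)%type.
Let S : pred {ffun cell -> bool} :=
  fun f => ~~ `[< collision_bound alpha t1 t2 (grid_mx f) >].
Let q : R := \sum_(f | S f) bernoulli_mass (fun e : cell => prob_one R n e.1) f.
Hypothesis q_le : q <= 2^-1.
Notation cost := (attempt_cost t n).
Hypothesis cost_gt0 : (0 < cost)%N.
Let fails (N : nat) : set Omega := [set w | all_fail alpha t1 t2 (X ^~ w) N].

Let failsE N : fails N = [set w | forall m, (m < N)%N -> S (mx_grid (X m w))].
Proof.
apply/seteqP; split=> w /=.
  move=> /all_failP h m /h; rewrite /S mx_gridK; apply: contra => /asboolP ok.
  exact/attemptP.
move=> h; apply/all_failP => m /h; rewrite /S mx_gridK; apply: contra => ok.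
by apply/asboolP/attemptP.
Qed.

Let fails_measurable N : measurable (fails N).
Proof. by rewrite failsE; exact: (all_copies_measurable randX S N). Qed.

Let fails_prob N : P (fails N) = (q ^+ N)%:E.
Proof. by rewrite failsE (all_copies_prob randX). Qed.

Let q_ge0 : 0 <= q.
Proof. by rewrite -lee_fin -[q]expr1 -fails_prob. Qed.

Let partial_sum_le N : \sum_(0 <= k < N) q ^+ k <= 2.
Proof.
suff : \sum_(0 <= k < N) q ^+ k <= 2 * (1 - 2^-1 ^+ N).
  by move=> h; apply: le_trans h _; have : 0 <= 2^-1 ^+ N :> R by []; lra.
elim: N => [|N IH]; first by rewrite big_geq // expr0 subrr mulr0.
rewrite big_nat_recr //=.
have : q ^+ N <= 2^-1 ^+ N by rewrite lerXn2r ?nnegrE.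
by rewrite exprS; lra.
Qed.

Lemma runtime_measurable :
  measurable_fun setT (fun w => runtime alpha t1 t2 (X ^~ w)).
Proof.
under eq_fun do rewrite runtimeE //.
apply: (@ge0_emeasurable_sum _ _ _ _
  (fun N w => ((cost%:R : R) * (all_fail alpha t1 t2 (X ^~ w) N)%:R)%:E) xpredT).
  by move=> N w _ _; rewrite lee_fin mulr_ge0.
move=> N _; apply/measurable_EFinP; apply: measurable_funM => //.
rewrite (_ : (fun w => _) = (\1_(fails N) : Omega -> R)); first exact: measurable_indic.
by apply/funext => w; rewrite indicE mem_setE.
Qed.

(** Sum and integral of nonnegative terms are exchanged; attempt [N] is reached with probability
    q^N, and the geometric series is at most 2. *)
Lemma expected_runtime_le :
  (\int[P]_w runtime alpha t1 t2 (X ^~ w) <= (2 * cost%:R)%:E)%E.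
Proof.
pose h N w : \bar R := ((cost%:R : R) * (all_fail alpha t1 t2 (X ^~ w) N)%:R)%:E.
have hE N : h N = (fun w => (cost%:R)%:E * (\1_(fails N) w)%:E)%E.
  by apply/funext => w; rewrite /h EFinM indicE mem_setE.
have h_ge0 N w : (0 <= h N w)%E by rewrite lee_fin mulr_ge0.
under eq_integral do rewrite runtimeE //.
rewrite (integral_nneseries P measurableT (f := h)) //; last first.
  move=> N; rewrite hE.
  by apply: measurable_funeM; apply/measurable_EFinP; apply: measurable_indic.
have intE N : (\int[P]_w h N w)%E = (cost%:R * q ^+ N)%:E.
  rewrite hE.
  rewrite ge0_integralZl //.
  - by rewrite integral_indic // setIT [X in (_ * X)%E](fails_prob N) -EFinM.
  - by apply/measurable_EFinP; apply: measurable_indic.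
apply: lime_le; first by apply: is_cvg_nneseries => N _ _; exact: integral_ge0.
apply: nearW => N; under eq_bigr do rewrite intE.
rewrite sumEFin lee_fin -mulr_sumr mulrC; exact: ler_wpM2r.
Qed.

Lemma all_fail_negligible : P (\bigcap_N fails N) = 0.
Proof.
have mA : measurable (\bigcap_N fails N) by apply: bigcap_measurable.
have fin : P (\bigcap_N fails N) \is a fin_num by exact: fin_num_measure.
have le_q N : fine (P (\bigcap_N fails N)) <= q ^+ N.
  rewrite -lee_fin fineK // -fails_prob le_measure ?inE //.
  by move=> w h; apply: h.
have x_ge0 : 0 <= fine (P (\bigcap_N fails N)) by rewrite fine_ge0.
rewrite -(fineK fin); congr EFin; apply/eqP; rewrite eq_le x_ge0 andbT.
set x := fine _ in le_q x_ge0 *; rewrite leNgt; apply/negP => x_gt0.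
(* As x <= q^k for every k, summing gives N x <= 2 for all N, which no positive x satisfies. *)
have xN N : N%:R * x <= 2.
  apply: le_trans (partial_sum_le N).
  rewrite -[N in N%:R]subn0 -sumr_const_nat mulr_suml; apply: ler_sum => k _.
  by rewrite mul1r.
have := truncnS_gt (2 / x); rewrite ltr_pdivrMr //.
by rewrite ltNge xN.
Qed.

Lemma first_success_measurable l :
  measurable [set w | first_success alpha t1 t2 (X ^~ w) l].
Proof.
rewrite (_ : [set w | _] = fails l `\` fails l.+1); first exact: measurableD.
apply/seteqP; split=> w /=.
  move=> [ok ko]; split; first exact/all_failP.
  by move=> /all_failP/(_ l (leqnn _)); rewrite ok.
move=> [/all_failP ko nko]; split=> //; apply: contrapT => /negP nok.
apply: nko; apply/all_failP => i; rewrite ltnS leq_eqVlt => /orP[/eqP -> //|].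
exact: ko.
Qed.

Variable Q : 'M[bool]_(t, n) -> Prop.
Hypothesis boundQ : forall M, collision_bound alpha t1 t2 M -> Q M.
Variable B : R.
Hypothesis cost_le : cost%:R <= B.
Let good : set Omega := [set w | exists M T,
  [/\ outputs alpha t1 t2 (X ^~ w) M T, T%:R <= B & Q M]].

Let first_successQ w l : first_success alpha t1 t2 (X ^~ w) l -> Q (X l w).
Proof. by case=> /attemptP /boundQ. Qed.

(** Indexing by the first success turns the existential over outputs and times into a countable
    union of measurable sets. *)
Let goodE : good = \bigcup_l
  (if (l.+1 * cost)%:R <= B then [set w | first_success alpha t1 t2 (X ^~ w) l]
   else set0).
Proof.
apply/seteqP; split=> w.
  move=> [M [T [/outputsE[l [lP _ ->]] TB _]]].
  by exists l => //; rewrite TB.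
case=> l _; case: ifP => // lB lP; exists (X l w), (l.+1 * cost)%N; split=> //.
  by apply/outputsE; exists l.
exact: first_successQ lP.
Qed.

Lemma good_measurable : measurable good.
Proof.
rewrite goodE; apply: bigcup_measurable => l _.
by case: ifP => _ //; exact: first_success_measurable.
Qed.

(** Success at the very first attempt suffices: it has probability 1 - q and costs one attempt. *)
Lemma good_prob : ((1 - q)%:E <= P good)%E.
Proof.
have -> : ((1 - q)%:E = P (~` fails 1))%E.
  by rewrite probability_setC // fails_prob expr1.
apply: le_measure; rewrite ?inE //.
- exact: measurableC.
- exact: good_measurable.
move=> w nf; rewrite goodE; exists 0%N => //; rewrite mul1n cost_le; split=> //.
apply: contrapT => /negP nok; apply: nf; apply/all_failP => i.
by rewrite ltnS leqn0 => /eqP ->.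
Qed.

Lemma outputs_ae :
  {ae P, forall w, exists M T, outputs alpha t1 t2 (X ^~ w) M T /\ Q M}.
Proof.
exists (\bigcap_N fails N); split.
- exact: bigcap_measurable.
- exact: all_fail_negligible.
move=> w /= none N _; apply/all_failP => i _; apply/negP => ok; apply: none.
have [l lP] : exists l, first_success alpha t1 t2 (X ^~ w) l.
  by apply: first_success_ex; exists i.
exists (X l w), (l.+1 * cost)%N; split; first by apply/outputsE; exists l.
exact: first_successQ lP.
Qed.

End Algorithm.

(** * Size, elongation and polynomial cost at alpha/2 *)

Section Assembly.
Variables (R : realType) (eps y alpha : R) (n : nat).
Hypotheses (eps_gt0 : 0 < eps) (y_ge1 : 192%:R ^+ 2 <= y) (alpha01 : 0 < alpha <= 1).
Hypothesis n_ge2 : (2 <= n)%N.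
Let a : R := alpha / 2%:R.
Let c : R := y ^+ 2.
Let t : nat := nrows eps c a n.

Let alpha_gt0 : 0 < alpha. Proof. by case/andP: alpha01. Qed.
Let a_gt0 : 0 < a. Proof. by rewrite divr_gt0. Qed.
Let a_le : a <= 2^-1. Proof. by case/andP: alpha01 => _; rewrite /a; lra. Qed.
Let y_ge : 32%:R <= y. Proof. by apply: le_trans y_ge1; lra. Qed.
Let c_ge : 2 <= c.
Proof.
rewrite /c expr2; have := ler_pM (ler0n R 32) (ler0n R 32) y_ge y_ge; lra.
Qed.
Let n_ge1 : 1 <= n%:R :> R. Proof. by rewrite ler1n ltnW. Qed.

Lemma cols_le_nrows : (n <= t)%N.
Proof.
have E_ge1 : 1 <= (a `^ (2%:R + eps))^-1.
  rewrite powR_expR_log // -[leLHS]expR0 ler_expR; have Lam_ge : 2^-1 <= - ln a := logV_ge a_gt0 a_le.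
  by apply: mulr_ge0; have := eps_gt0; lra.
have L_ge := ln_nat_ge R n_ge2.
have cE_ge : 2 <= c / a `^ (2%:R + eps).
  by rewrite -[leLHS]mulr1; apply: ler_pM.
have n_le : n%:R <= c / a `^ (2%:R + eps) * n%:R ^+ 2 * ln n%:R.
  have h1 : 2 * n%:R <= c / a `^ (2%:R + eps) * n%:R ^+ 2.
    apply: ler_pM => //; rewrite expr2 -[leLHS]mulr1; exact: ler_pM.
  have := ler_pM (_ : 0 <= 2 * n%:R) (_ : 0 <= 2^-1) h1 L_ge.
  by move=> h; apply: (le_trans _ (h _ _)); rewrite ?mulr_ge0 ?invr_ge0 //; lra.
rewrite /t /nrows; apply: leqW; rewrite truncn_ge_nat //.
exact: le_trans n_le.
Qed.

Lemma tau2_le k : (tau2 eps c a n k)%:R <=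
  c * 2 `^ (2%:R + eps) * (k%:R ^+ 2 / alpha `^ (2%:R + eps) * ln n%:R).
Proof.
have L_ge0 : 0 <= ln (n%:R : R) by apply: ln_ge0.
have aE : (a `^ (2%:R + eps))^-1 = 2 `^ (2%:R + eps) / alpha `^ (2%:R + eps).
  by rewrite /a powRM ?invr_ge0 ?(ltW alpha_gt0) // invfM -!powRN -powR_inv1 //
    -powRrM mulN1r opprK mulrC.
have -> : c * 2 `^ (2%:R + eps) * (k%:R ^+ 2 / alpha `^ (2%:R + eps) * ln n%:R) =
    c * (k%:R ^+ 2 / a `^ (2%:R + eps)) * ln n%:R by rewrite aE; ring.
rewrite /tau2 truncn_le; apply: mulr_ge0 L_ge0; apply: (mulr_ge0 (sqr_ge0 _)).
by apply: divr_ge0 (powR_ge0 _ _); rewrite sqr_ge0.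
Qed.

(** The cost is at most 40 n^3 t^2 with t <= 2 c n^3 (2/alpha)^m. This gives n^9, alpha^(-2m), 4^m,
    and 320 = 2 * 40 * 4; both n and 1/alpha are then bounded by n/alpha. *)
Lemma attempt_cost_poly (m : nat) : 2%:R + eps <= m%:R ->
  2 * (attempt_cost t n)%:R <=
  320%:R * c ^+ 2 * 4%:R ^+ m * (n%:R / alpha) ^+ (9 + 2 * m).
Proof.
move=> m_ge.
have t_gt0 : (0 < t)%N by [].
have n_gt0 : (0 < n)%N by apply: ltnW.
have cost_le : (attempt_cost t n)%:R <= 40%:R * n%:R ^+ 3 * t%:R ^+ 2 :> R.
  by rewrite -!natrX -!natrM ler_nat attempt_cost_le.
have tE := nrows_le eps_gt0 a_gt0 a_le n_ge2 y_ge1.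
have E_le : expR ((2%:R + eps) * - ln a) <= (2 / alpha) ^+ m.
  rewrite -powR_expR_log // -[2 / alpha]invf_div -/a exprVn -powR_mulrn ?(ltW a_gt0) //.
  rewrite lef_pV2 ?posrE ?powR_gt0 // ger_powR // a_gt0 /=; have := a_le; lra.
have t_le : t%:R <= 2%:R * c * n%:R ^+ 3 * (2 / alpha) ^+ m.
  apply: le_trans tE _; rewrite -/c.
  have c_ge0 : 0 <= c by have := c_ge; lra.
  have h : 0 <= 2 * c * n%:R ^+ 3 by apply: mulr_ge0; [exact: mulr_ge0 (ler0n _ 2) c_ge0 | rewrite exprn_ge0].
  by have := ler_wpM2l h E_le; lra.
have t2_le : t%:R ^+ 2 <= (2%:R * c * n%:R ^+ 3 * (2 / alpha) ^+ m) ^+ 2.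
  by rewrite lerXn2r ?nnegrE // (le_trans _ t_le).
have n3_ge0 : 0 <= 40%:R * n%:R ^+ 3 :> R by rewrite mulr_ge0 ?exprn_ge0.
have bound : 2 * (attempt_cost t n)%:R <=
    320%:R * c ^+ 2 * 4%:R ^+ m * (n%:R ^+ 9 * alpha^-1 ^+ (2 * m)).
  have -> : 320%:R * c ^+ 2 * 4%:R ^+ m * (n%:R ^+ 9 * alpha^-1 ^+ (2 * m)) =
      2 * (40%:R * n%:R ^+ 3 * (2%:R * c * n%:R ^+ 3 * (2 / alpha) ^+ m) ^+ 2).
    have e1 : alpha^-1 ^+ (2 * m) = (alpha^-1 ^+ m) ^+ 2 by rewrite mulnC exprM.
    have e2 : 4%:R ^+ m = (2 ^+ m) ^+ 2 :> R.
      by rewrite -exprM mulnC exprM; congr (_ ^+ _); rewrite expr2; lra.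
    have e3 : (2 / alpha) ^+ m = 2 ^+ m * alpha^-1 ^+ m by rewrite exprMn.
    by rewrite e1 e2 e3; move: (2 ^+ m) (alpha^-1 ^+ m) => u v; ring.
  by rewrite ler_pM2l //; apply: le_trans cost_le _; rewrite ler_wpM2l.
apply: le_trans bound _; apply: ler_wpM2l.
  exact: mulr_ge0 (mulr_ge0 (ler0n _ 320) (sqr_ge0 _)) (exprn_ge0 _ (ler0n _ 4)).
have inv_ge1 : 1 <= alpha^-1 by case/andP: alpha01 => ? ?; rewrite invf_ge1.
rewrite exprD; apply: ler_pM.
- by rewrite exprn_ge0.
- by rewrite exprn_ge0 // (le_trans ler01).
- rewrite lerXn2r ?nnegrE //; first by rewrite divr_ge0 // ltW.
  by rewrite ler_peMr.
- rewrite lerXn2r ?nnegrE ?divr_ge0 ?invr_ge0 ?(ltW alpha_gt0) //.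
  by rewrite ler_peMl // (le_trans ler01).
Qed.

End Assembly.

Theorem theorem1 (R : realType) (eps : R) (eps_gt0 : 0 < eps) :
  exists D : nat, forall b : R, 0 < b ->
  exists2 c0 : R, 0 < c0 & forall c : R, c0 <= c ->
  exists K A : R, forall alpha : R, 0 < alpha <= 1 ->
  exists tau : nat -> nat -> nat, forall n : nat, (2 <= n)%N ->
    (forall k : nat, (1 < k <= n)%N ->
       (tau n k)%:R <= K * (k%:R ^+ 2 / alpha `^ (2%:R + eps) * ln n%:R)) /\
    forall (d : measure_display) (Omega : measurableType d)
      (P : probability Omega R)
      (X : nat -> Omega -> 'M[bool]_(nrows eps c (alpha / 2%:R) n, n)),
    random_matrices P X ->
    let alg_outputs (w : Omega) :=
      outputs (alpha / 2%:R) (tau1 c) (tau2 eps c (alpha / 2%:R)) (X ^~ w) in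
    let alg_time (w : Omega) : \bar R :=
      runtime (alpha / 2%:R) (tau1 c) (tau2 eps c (alpha / 2%:R)) (X ^~ w) in
    let poly_time : R := A * (n%:R / alpha) ^+ D in
    let good : set Omega :=
      [set w | exists M T,
         [/\ alg_outputs w M T, T%:R <= poly_time & URSC alpha tau M]] in
    (measurable good /\ ((1 - n%:R `^ (- b))%:E <= P good)%E) /\
    [/\ {ae P, forall w, exists M T, alg_outputs w M T /\ URSC alpha tau M},
        measurable_fun setT alg_time
      & (\int[P]_w alg_time w <= poly_time%:E)%E].
Proof.
(* An integer exponent above 2 + eps makes the running time polynomial, with a degree depending on
   eps alone. *)
pose m : nat := (Num.truncn (2%:R + eps)).+1.
have m_ge : 2%:R + eps <= m%:R by apply/ltW/truncnS_gt.
exists (9 + 2 * m)%N => b b_gt0.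
(* A sum of nonnegative terms, one for each lower bound required of y. The exponent b + 1 replaces b
   so that the failure probability is at most 1/2 already for n = 2, as the expected time
   requires. *)
pose y0 : R := 192%:R ^+ 2 + 24%:R * (31%:R + (b + 1)) + 24%:R * (8%:R + 4%:R * eps) / eps.
have y1_ge0 : 0 <= 24%:R * (31%:R + (b + 1)) by lra.
have y2_ge0 : 0 <= 24%:R * (8%:R + 4%:R * eps) / eps.
  by rewrite divr_ge0 ?(ltW eps_gt0) //; lra.
have y0_gt0 : 0 < y0 by rewrite /y0; lra.
exists (y0 ^+ 2) => [|c c_ge]; first by rewrite exprn_gt0.
have c_ge0 : 0 <= c by apply: le_trans c_ge; rewrite sqr_ge0.
have y_ge : y0 <= Num.sqrt c.
  by rewrite -[y0]ger0_norm ?(ltW y0_gt0) // -sqrtr_sqr ler_sqrt.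
rewrite -[c]sqr_sqrtr // {c_ge c_ge0}; move: (Num.sqrt c) y_ge => y y_ge {c}.
have y_ge1 : 192%:R ^+ 2 <= y by apply: le_trans y_ge; rewrite /y0; lra.
have y_ge2 : 24%:R * (31%:R + (b + 1)) <= y.
  by apply: le_trans y_ge; have : 0 <= 192%:R ^+ 2 :> R by []; rewrite /y0; lra.
have y_ge3 : 24%:R * (8%:R + 4%:R * eps) <= y * eps.
  rewrite -ler_pdivrMr //; apply: le_trans y_ge.
  by have : 0 <= 192%:R ^+ 2 :> R by []; rewrite /y0; lra.
have y_ge4 : 32%:R <= y by apply: le_trans y_ge1; lra.
exists (y ^+ 2 * 2 `^ (2%:R + eps)), (320%:R * (y ^+ 2) ^+ 2 * 4%:R ^+ m) => alpha alpha01.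
have [alpha_gt0 alpha_le1] := andP alpha01.
exists (tau2 eps (y ^+ 2) (alpha / 2%:R)) => n n_ge2; split.
  by move=> k _; exact: tau2_le.
move=> d Omega P X randX; cbv zeta.
have a_gt0 : 0 < alpha / 2%:R by rewrite divr_gt0.
have a_le : alpha / 2%:R <= 2^-1 by lra.
have q_le := collision_bound_fail_mass eps_gt0 a_gt0 a_le n_ge2 y_ge1 y_ge2 y_ge3.
have n_ge1 : 1 <= n%:R :> R by rewrite ler1n ltnW.
have q_half : n%:R `^ (- (b + 1)) <= 2^-1 :> R.
  apply: (@le_trans _ _ (n%:R `^ (- 1))); first by rewrite ler_powR //; lra.
  by rewrite powR_inv1 // lef_pV2 ?posrE ?ler_nat // ltr0n ltnW.
have cost_gt0 : (0 < attempt_cost (nrows eps (y ^+ 2) (alpha / 2%:R) n) n)%N.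
  by rewrite /attempt_cost addn_gt0 muln_gt0 (ltnW n_ge2).
have cost_le := attempt_cost_poly eps_gt0 y_ge1 alpha01 n_ge2 m_ge.
have cost_le1 := le_trans (ler_peMl (ler0n _ _) (ler1n R 2)) cost_le.
have tau2_lt k : (1 < k <= n)%N ->
    (tau2 eps (y ^+ 2) (alpha / 2%:R) n k < nrows eps (y ^+ 2) (alpha / 2%:R) n)%N.
  by case/andP=> k_ge2 kn; exact: tau2_lt_nrows.
have boundQ M := @collision_bound_URSC R _ n alpha (tau1 (y ^+ 2))
  (tau2 eps (y ^+ 2) (alpha / 2%:R)) M alpha_gt0
  (cols_le_nrows eps_gt0 y_ge1 alpha01 n_ge2)
  tau2_lt.
split; [split|split].
- exact (good_measurable randX boundQ _).
- apply: le_trans (good_prob randX boundQ cost_le1); rewrite lee_fin lerD2l lerN2.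
  by apply: le_trans q_le _; rewrite ler_powR //; lra.
- exact (outputs_ae randX (le_trans q_le q_half) boundQ).
- exact (runtime_measurable _ _ _ randX cost_gt0).
- apply: le_trans (expected_runtime_le randX (le_trans q_le q_half) cost_gt0) _.
  by rewrite lee_fin.
Qed.
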